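(* Let $\Delta$ be a $(d-1)$-dimensional tree complex on $[n]$, let $k$ be a field and $S=k[x_1,\dots,x_n]$. Let $\Delta_0=\Delta,\Delta_1,\dots,\Delta_{n-d}$ and $\Sigma_0,\dots,\Sigma_{n-d-1}$ be obtained from $\Delta$ by the iterated clique tree construction (described in the context), and for $0\le t<n-d$ let $$M_t=\langle x_p^{\,n-d-t}x_q^{\,n-d-t} : \{p,q\}\in\Sigma_t\rangle,\qquad M=M_0+M_1+\cdots+M_{n-d-1}.$$ Then $M$ is a deformation of the Stanley-Reisner ideal $I_\Delta\subset S$ that is generic and Cohen-Macaulay.
   Context: A simplicial complex $\Delta$ on $[n]=\{1,\dots,n\}$ is a non-empty collection of subsets of $[n]$ (faces), closed under taking subsets, with $\{i\}\in\Delta$ for all $i\in[n]$; $\dim(\sigma)=|\sigma|-1$ and $\dim(\Delta)$ is the maximum dimension of a face; facets are the maximal faces; minimal non-faces are the minimal subsets of $[n]$ not in $\Delta$. A shelling of a complex all of whose facets have the same dimension $d-1$ is an ordering $F_1,\dots,F_t$ of its facets such that for $1<i\le t$ the subcomplex of faces of $F_i$ contained in some $F_l$, $l<i$, is pure of dimension $d-2$. $\Delta$ is a tree complex if it is pure and has a shelling $F_1,\dots,F_t$ such that for each $1<i\le t$ there is $j_i\in F_i$ with $j_i\notin F_1\cup\cdots\cup F_{i-1}$. Iterated clique tree construction. For a pure $(e-1)$-dimensional tree complex $\Delta'$ the facet graph $FG(\Delta')$ has the facets as nodes, two facets being adjacent if they share $e-1$ elements. A clique tree of $FG(\Delta')$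 is a spanning tree $T$ of $FG(\Delta')$ such that for every vertex $i$ of $\Delta'$ the subgraph of $T$ induced on the facets containing $i$ is connected. For an edge $e$ of $T$ joining facets $F,F'$, the set $F\cup F'$ contains a unique minimal non-face $\{p_e,q_e\}$ of $\Delta'$, namely the symmetric difference of $F$ and $F'$. Put $\Delta_0=\Delta$. For $0\le t<n-d$, choose any clique tree $T_{\Delta_t}$ of $FG(\Delta_t)$, let $\Sigma_t=\{\{p_e,q_e\}: e \text{ an edge of } T_{\Delta_t}\}$, and let $\Delta_{t+1}$ be the simplicial complex on $[n]$ whose facets are the sets $F\cup F'$ for $\{F,F'\}$ an edge of $T_{\Delta_t}$. Then each $\Delta_t$ is a tree complex of dimension $d+t-1$, and $\Delta_t$ is a simplex only for $t=n-d$. The Stanley-Reisner ideal is $I_\Delta=\langle \prod_{i\in\sigma}x_i : \sigma\subseteq[n],\ \sigma\notin\Delta\rangle$. A deformation of a square-free monomial ideal $I$ with minimal generators $m_1,\dots,m_r$ is a monomial ideal $\langle m_1^*,\dots,m_r^*\rangle$ such that for each $i$, if $m_i=x_{i_1}\cdots x_{i_s}$, then $m_i^*=x_{i_1}^{j_1}\cdots x_{i_s}^{j_s}$ for some positive integers $j_1,\dots,j_s$. $x^{a}$ strictly divides $x^{b}$ if $a_i<b_i$ for every $i$ with $a_i>0$. A monomial ideal is generic if for any two distinct minimal generators $m_i,m_j$ having the same positive degree in some variable, there is a third minimal generator that strictly divides $\mathrm{lcm}(m_i,m_j)$. An ideal $M$ is Cohen-Macaulay if $S/M$ is a Cohen-Macaulay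 ring. *)

(* Defs.v *)
From HB Require Import structures.
From mathcomp Require Import all_boot all_order all_algebra.
From mathcomp Require Import mpoly.

Set Implicit Arguments.
Unset Strict Implicit.
Unset Printing Implicit Defensive.

Import GRing.Theory.
Local Open Scope ring_scope.

Section Graphs.
Variable W : finType.
Implicit Types (V : {set W}) (g e : rel W).

(* The subgraph of e induced on V is connected; paths must stay inside V. *)
Definition connected_on V e : Prop :=
  {in V &, forall x y, connect [rel u v | [&& u \in V, v \in V & e u v]] x y}.

(* An edge traversed back and forth is a ucycle of size 2, hence the bound. *)
Definition acyclic e : Prop :=
  forall c : seq W, ucycle e c -> (size c <= 2)%N.

Definition spanning_tree V g e : Prop :=
  [/\ ssrbool.symmetric e, subrel e g, connected_on V e & acyclic e].

End Graphs.

Section Complexes.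
Variable n : nat.
Implicit Types (D : {set {set 'I_n}}) (s F : {set 'I_n}).

Definition simplicial_complex D : Prop :=
  [/\ D != set0,
      (forall s F, s \subset F -> F \in D -> s \in D)
    & forall i : 'I_n, [set i] \in D].

Definition facets D : {set {set 'I_n}} :=
  [set F : {set 'I_n} | maxset (mem D) F].

Definition min_nonfaces D : {set {set 'I_n}} :=
  [set s : {set 'I_n} | minset (fun u => u \notin D) s].

Definition max_face_size D : nat := (\max_(s in D) #|s|)%N.

(* An int, so that the complex {set0} has dimension -1. *)
Definition cx_dim D : int := (max_face_size D)%:Z - 1.

Definition pure D : Prop := {in facets D &, forall F F', #|F| = #|F'|}.

Definition earlier_faces (fs : seq {set 'I_n}) (i : nat) : {set {set 'I_n}} :=
  [set s : {set 'I_n} | (s \subset nth set0 fs i)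
                        && has (fun F => s \subset F) (take i fs)].

Definition shelling D (fs : seq {set 'I_n}) : Prop :=
  [/\ uniq fs, fs =i facets D
    & forall i, (0 < i < size fs)%N ->
        pure (earlier_faces fs i) /\
        cx_dim (earlier_faces fs i) = cx_dim D - 1].

Definition tree_complex D : Prop :=
  [/\ simplicial_complex D, pure D
    & exists2 fs : seq {set 'I_n}, shelling D fs
      & forall i, (0 < i < size fs)%N ->
          exists2 j : 'I_n, j \in nth set0 fs i
                          & j \notin \bigcup_(F <- take i fs) F].

Definition facet_graph D : rel {set 'I_n} := fun F F' =>
  [&& F \in facets D, F' \in facets D, F != F'
    & #|F :&: F'|.+1 == max_face_size D].

Definition clique_tree D (T : rel {set 'I_n}) : Prop :=
  spanning_tree (facets D) (facet_graph D) T /\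
  forall i : 'I_n, connected_on [set F in facets D | i \in F] T.

Definition below_edge (T : rel {set 'I_n}) s : bool :=
  [exists F : {set 'I_n}, exists F' : {set 'I_n},
     T F F' && (s \subset F :|: F')].

(* The minimal non-faces {p_e, q_e} of D contained in the unions of the two
   ends of the edges e of T. *)
Definition edge_nonfaces D (T : rel {set 'I_n}) : {set {set 'I_n}} :=
  [set s in min_nonfaces D | below_edge T s].

(* The F :|: F' all have the same size when T is a clique tree, so they are
   exactly the facets of the complex they generate. *)
Definition edge_union_complex (T : rel {set 'I_n}) : {set {set 'I_n}} :=
  [set s : {set 'I_n} | below_edge T s].

Definition iterated_clique_tree D (d : nat)
    (Ds : nat -> {set {set 'I_n}}) (Ts : nat -> rel {set 'I_n}) : Prop :=
  Ds 0%N = D /\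
  forall t, (t < n - d)%N ->
    clique_tree (Ds t) (Ts t) /\ Ds t.+1 = edge_union_complex (Ts t).

End Complexes.

Section Ideals.
Variable R : comNzRingType.
Implicit Types (P : {pred R}) (s : seq R).

Definition ideal_gen (G : R -> Prop) (x : R) : Prop :=
  exists2 cs : seq (R * R), (forall c, c \in cs -> G c.2)
                          & x = \sum_(c <- cs) c.1 * c.2.

Definition ideal_sum m (I : 'I_m -> R -> Prop) (x : R) : Prop :=
  exists2 y : 'I_m -> R, (forall t, I t (y t)) & x = \sum_t y t.

Definition seq_ideal s : R -> Prop := ideal_gen (fun x => x \in s).

(* Ideals are quantified as boolean predicates, i.e. as all ideals classically.
   idealr_closed asks for a proper ideal, which costs nothing here since the
   unit ideal is generated by 1. *)
Definition noetherian : Prop :=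
  forall P, idealr_closed P ->
    exists s, forall x, x \in P <-> seq_ideal s x.

Definition prime_ideal P : Prop := idealr_closed P /\ prime_idealr_closed P.

Definition maximal_ideal P : Prop :=
  idealr_closed P /\
  forall Q : {pred R}, idealr_closed Q -> {subset P <= Q} -> {subset Q <= P}.

Definition prime_chain_to P (c : nat) (C : nat -> {pred R}) : Prop :=
  [/\ forall i, (i <= c)%N -> prime_ideal (C i),
      forall i, (i < c)%N ->
        {subset C i <= C i.+1} /\ ~ {subset C i.+1 <= C i}
    & C c =i P].

Definition height_is P (c : nat) : Prop :=
  (exists C, prime_chain_to P c C) /\
  (forall c' C, prime_chain_to P c' C -> (c' <= c)%N).

Definition regular_sequence s : Prop :=
  (forall i y, (i < size s)%N ->
     seq_ideal (take i s) (s`_i * y) -> seq_ideal (take i s) y) /\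
  ~ seq_ideal s 1.

Definition depth_is P (c : nat) : Prop :=
  (exists s, [/\ regular_sequence s, {subset s <= P} & size s = c]) /\
  (forall s, regular_sequence s -> {subset s <= P} -> (size s <= c)%N).

(* Eisenbud, Commutative Algebra, Section 18.2: depth P = codim P for every
   maximal ideal P, where depth P is the length of the longest regular sequence
   in P. It is the depth of the localization at P, as P is maximal. *)
Definition cohen_macaulay_ring : Prop :=
  noetherian /\
  forall P, maximal_ideal P -> exists2 c, height_is P c & depth_is P c.

End Ideals.

(* The quotient type needs a boolean ideal, so I is presented by some J. *)
Definition cohen_macaulay_ideal (S : comNzRingType) (I : S -> Prop) : Prop :=
  exists2 J : idealr S, (forall f, f \in J <-> I f)
                      & cohen_macaulay_ring {ideal_quot J}.

Section MonomialIdeals.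
Variables (k : fieldType) (n : nat).
Local Notation S := {mpoly k[n]}.
Implicit Types (I J : S -> Prop) (m : 'X_{1..n}) (B : 'X_{1..n} -> Prop).

Definition monomials_ideal B : S -> Prop :=
  ideal_gen (fun f => exists2 m, B m & f = 'X_[m]).

Definition monomial_ideal I : Prop :=
  exists B, forall f, I f <-> monomials_ideal B f.

Definition squarefree_monomial_ideal I : Prop :=
  exists2 B, (forall m, B m -> forall i, (m i <= 1)%N)
           & forall f, I f <-> monomials_ideal B f.

Definition min_gen I m : Prop :=
  I 'X_[m] /\ forall m', I 'X_[m'] -> (m' <= m)%MM -> m' = m.

Definition deformation J I : Prop :=
  squarefree_monomial_ideal I /\
  exists2 star : 'X_{1..n} -> 'X_{1..n},
    (forall m, min_gen I m -> forall i, (0 < star m i)%N = (0 < m i)%N)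
  & forall f, J f <->
      monomials_ideal (fun m' => exists2 m, min_gen I m & m' = star m) f.

Definition strictly_divides m m' : Prop :=
  forall i, (0 < m i)%N -> (m i < m' i)%N.

Definition generic_ideal I : Prop :=
  monomial_ideal I /\
  forall m1 m2, min_gen I m1 -> min_gen I m2 -> m1 <> m2 ->
    (exists2 i, (0 < m1 i)%N & m1 i = m2 i) ->
    exists m3, [/\ min_gen I m3, m3 <> m1, m3 <> m2
                 & strictly_divides m3 (mlcm m1 m2)].

Definition stanley_reisner (D : {set {set 'I_n}}) : S -> Prop :=
  ideal_gen (fun f => exists2 s, s \notin D & f = \prod_(i in s) 'X_i).

Definition pair_power_ideal (e : nat) (Sigma : {set {set 'I_n}}) : S -> Prop :=
  ideal_gen (fun f => exists p q : 'I_n,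
    [/\ p != q, [set p; q] \in Sigma & f = 'X_p ^+ e * 'X_q ^+ e]).

Definition clique_tree_ideal (d : nat)
    (Ds : nat -> {set {set 'I_n}}) (Ts : nat -> rel {set 'I_n}) : S -> Prop :=
  ideal_sum (fun t : 'I_(n - d) =>
    pair_power_ideal (n - d - t) (edge_nonfaces (Ds t) (Ts t))).

End MonomialIdeals.

Arguments stanley_reisner k {n} D.
Arguments clique_tree_ideal k {n} d Ds Ts.

(* Main.v *)
From HB Require Import structures.
Require Import Defs.
From mathcomp Require Import all_boot all_order all_algebra.
From mathcomp Require Import mpoly.
From mathcomp Require Import zify ring.
From mathcomp Require boolp classical_sets.

(* The level sets L_e = {i : a_i >= e} of the exponent vector of a monomial x^a
   show that x^a is not in M iff L_(n-d-r) is a face of Delta_r for every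
   r < n-d: a face L of Delta_(r+1) is a face of Delta_r iff it contains no
   pair of Sigma_r.  A facet of Delta_(r+1) is F :|: F' with F, F' facets of
   Delta_r that differ by one vertex, which cuts the standard monomials, step by
   step, into translates of the sets of monomials supported on facets of Delta.
   This filters S/M by copies of the rings k[x_i : i in F], F a facet.

   Delta has a proper d-colouring of its vertices.  Let theta_c be the sum of
   the variables of colour c.  On k[x_i : i in F] it acts as a variable, so for
   monic g_c the sequence g_c(theta_c) is regular on every piece of the
   filtration, hence on S/M by the depth lemma.  By Zariski's lemma, for every
   maximal ideal P of S/M there are monic g_c with g_c(theta_c) in P, so the
   depth of P is at least d.  A regular sequence in P yields a chain of primes
   below P of the same length, and no chain is longer than d: elements
   separating a longer chain would be algebraically independent modulo its first
   member, which contains all variables but at most d (the argument of Coquand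
   and Lombardi).

   Genericity holds because removing an edge disconnects the clique tree: if
   {p, q} and {p, s} are in Sigma_t then {q, s} is in some Sigma_r, r > t. *)

Set Implicit Arguments.
Unset Strict Implicit.
Unset Printing Implicit Defensive.

Import GRing.Theory.
Local Open Scope ring_scope.

(** * Weakly regular sequences modulo an ideal *)

Section PropIdeals.
Variable R : comNzRingType.
Implicit Types (I J : R -> Prop) (x y z a : R) (s : seq R).

Definition is_ideal I : Prop :=
  [/\ I 0, forall x y, I x -> I y -> I (x + y) & forall a x, I x -> I (a * x)].

Definition adjoin I y : R -> Prop := fun x => exists u a, I u /\ x = u + a * y.

Lemma ideal_opp I x : is_ideal I -> I x -> I (- x).
Proof. by case=> _ _ IM /(IM (- 1)); rewrite mulN1r. Qed.

Lemma ideal_sub I x y : is_ideal I -> I x -> I y -> I (x - y).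
Proof.
move=> idI Ix Iy; have [_ ID _] := idI.
by apply: ID => //; apply: ideal_opp.
Qed.

Lemma ideal_mulr I a x : is_ideal I -> I x -> I (x * a).
Proof. by case=> _ _ IM Ix; rewrite mulrC; apply: IM. Qed.

Lemma ideal_big I (T : Type) (r : seq T) (P : pred T) (F : T -> R) :
  is_ideal I -> (forall i, P i -> I (F i)) -> I (\sum_(i <- r | P i) F i).
Proof. by case=> I0 ID _ IF; apply: big_ind. Qed.

Lemma adjoin_ideal I y : is_ideal I -> is_ideal (adjoin I y).
Proof.
case=> I0 ID IM; split.
- by exists 0, 0; rewrite mul0r addr0.
- move=> _ _ [u [a [Iu ->]]] [v [b [Iv ->]]]; exists (u + v), (a + b).
  by split; [exact: ID | rewrite mulrDl addrACA].
- move=> c _ [u [a [Iu ->]]]; exists (c * u), (c * a).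
  by split; [exact: IM | rewrite mulrDr mulrA].
Qed.

Lemma sub_adjoin I y x : I x -> adjoin I y x.
Proof. by exists x, 0; rewrite mul0r addr0. Qed.

Lemma mem_adjoin I y : is_ideal I -> adjoin I y y.
Proof. by case=> I0 _ _; exists 0, 1; rewrite mul1r add0r. Qed.

Lemma adjoin_min I J y x :
  is_ideal J -> (forall z, I z -> J z) -> J y -> adjoin I y x -> J x.
Proof. by case=> _ JD JM IJ Jy [u [a [Iu ->]]]; apply: JD; auto. Qed.

Lemma adjoin_congr I y z x :
  is_ideal I -> I (y - z) -> adjoin I y x -> adjoin I z x.
Proof.
move=> idI Iyz; have [_ ID IM] := idI; case=> u [a [Iu ->]].
exists (u + a * (y - z)), a; split; first by apply/ID/IM.
by rewrite -addrA -mulrDr subrK.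
Qed.

Lemma adjoinAC I y z x : adjoin (adjoin I y) z x -> adjoin (adjoin I z) y x.
Proof.
case=> _ [a [[u [b [Iu ->]]] ->]]; rewrite addrAC.
by exists (u + a * z), b; split; first by exists u, a.
Qed.

Lemma zero_ideal : is_ideal (fun x => x = 0).
Proof. by split=> [|x y -> ->|a x ->] //; rewrite ?addr0 ?mulr0. Qed.

Lemma ideal_genP (G : R -> Prop) : is_ideal (ideal_gen G).
Proof.
split.
- by exists [::]; rewrite ?big_nil.
- move=> _ _ [cs Gcs ->] [ds Gds ->]; exists (cs ++ ds); last by rewrite big_cat.
  by move=> c; rewrite mem_cat => /orP[/Gcs|/Gds].
- move=> a _ [cs Gcs ->]; exists [seq (a * c.1, c.2) | c <- cs].
    by move=> _ /mapP[c /Gcs Gc ->].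
  by rewrite big_map mulr_sumr; apply: eq_bigr => c _; rewrite mulrA.
Qed.

Lemma mem_ideal_gen (G : R -> Prop) x : G x -> ideal_gen G x.
Proof.
move=> Gx; exists [:: (1, x)]; last by rewrite big_seq1 mul1r.
by move=> c; rewrite inE => /eqP->.
Qed.

Lemma ideal_gen_min (G : R -> Prop) J x :
  is_ideal J -> (forall z, G z -> J z) -> ideal_gen G x -> J x.
Proof.
move=> idJ GJ [cs Gcs ->]; rewrite big_seq; apply: ideal_big => // c /Gcs/GJ.
by case: idJ => _ _; apply.
Qed.

Lemma seq_ideal_nil x : seq_ideal [::] x <-> x = 0.
Proof.
split=> [|->]; last by case: (ideal_genP (fun x => x \in [::])).
exact: (ideal_gen_min zero_ideal).
Qed.

Lemma seq_ideal_rcons s y x : seq_ideal (rcons s y) x <-> adjoin (seq_ideal s) y x.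
Proof.
split.
  apply: ideal_gen_min => [|z]; first exact/adjoin_ideal/ideal_genP.
  rewrite mem_rcons inE => /orP[/eqP->|zs]; first exact/mem_adjoin/ideal_genP.
  exact/sub_adjoin/mem_ideal_gen.
apply: adjoin_min; first exact: ideal_genP.
  move=> z; apply: ideal_gen_min => [|t ts]; first exact: ideal_genP.
  by apply: mem_ideal_gen; rewrite mem_rcons inE ts orbT.
by apply: mem_ideal_gen; rewrite mem_rcons mem_head.
Qed.

Lemma adjoin_ext I J y x :
  (forall z, I z <-> J z) -> adjoin I y x <-> adjoin J y x.
Proof. by move=> IJ; split=> -[u [a [/IJ Iu ->]]]; exists u, a. Qed.

End PropIdeals.

Section WeaklyRegular.

(** Properness is left out, so the condition also holds modulo the unit ideal. The ideal is a
    parameter that grows by [adjoin], which lets inductions on [s] start from any ideal. *)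
Fixpoint weakly_regular (R : comNzRingType) (I : R -> Prop) (s : seq R) : Prop :=
  if s is y :: s' then
    (forall z, I (y * z) -> I z) /\ weakly_regular (adjoin I y) s'
  else True.

Variable R : comNzRingType.
Implicit Types (I J : R -> Prop) (x y z a m : R) (s : seq R).

Lemma weakly_regular_ext I J s :
  (forall z, I z <-> J z) -> weakly_regular I s -> weakly_regular J s.
Proof.
elim: s I J => //= y s IHs I J IJ [regy regs]; split=> [z /IJ/regy/IJ//|].
by apply: IHs regs => z; apply: adjoin_ext.
Qed.

Lemma weakly_regular_congr I s t :
  is_ideal I -> size s = size t ->
  (forall i, (i < size s)%N -> I (s`_i - t`_i)) ->
  weakly_regular I s -> weakly_regular I t.
Proof.
elim: s t I => [|y s IHs] [|y' t] I idI //= [sz_st] Ist [regy regs].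
have Iyy': I (y - y') by apply: (Ist 0%N).
have adjE z : adjoin I y z <-> adjoin I y' z.
  by split; apply: adjoin_congr => //; rewrite -opprB; apply: ideal_opp.
split=> [z Iy'z|].
  apply: regy; rewrite -(subrK y' y) mulrDl; case: (idI) => _ ID _; apply: ID => //.
  exact: ideal_mulr.
apply: (weakly_regular_ext adjE); apply: IHs regs => //; first exact: adjoin_ideal.
by move=> i lti; apply/sub_adjoin/(Ist i.+1).
Qed.

Lemma weakly_regular_unit I s : is_ideal I -> I 1 -> weakly_regular I s.
Proof.
elim: s I => //= y s IHs I idI I1; split=> [z _|].
  by rewrite -(mulr1 z); case: idI => _ _; apply.
by apply: IHs; [exact: adjoin_ideal | exact: sub_adjoin].
Qed.

(* The depth lemma for 0 -> R/(I:m) -> R/I -> R/(I+m) -> 0. *)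
Lemma weakly_regular_colon I m s : is_ideal I ->
  weakly_regular (fun z => I (z * m)) s -> weakly_regular (adjoin I m) s ->
  weakly_regular I s.
Proof.
elim: s I => //= y s IHs I idI [regC WC] [regA WA].
have [I0 ID IM] := idI.
(* Regularity of [y] modulo [I + m] enters here: in [a * m = u + b * y] it puts [b] in [I + m], and
   subtracting a multiple of [y] from [a] lands in [I : m]. Thus [(I + y) : m] is [(I : m) + y], as
   the induction needs. *)
have colP a : adjoin I y (a * m) -> adjoin (fun z => I (z * m)) y a.
  case=> u [b [Iu abE]].
  have [u' [c [Iu' bE]]]: adjoin I m b.
    apply: regA; exists (- u), a; split; first exact: ideal_opp.
    by rewrite abE addKr mulrC.
  exists (a - c * y), c; split; last by rewrite subrK.
  suff ->: (a - c * y) * m = u + y * u' by apply/ID/IM.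
  by rewrite mulrBl abE bE mulrDl mulrAC (mulrC u') addrA addrK.
split=> [z Iyz|].
  have [u [a [Iu zE]]]: adjoin I m z by apply/regA/sub_adjoin.
  rewrite zE; apply: (ID _ _ Iu (regC _ _)); rewrite -mulrA.
  have ->: y * (a * m) = y * z - y * u by rewrite zE mulrDr addrC addKr.
  by apply: ideal_sub => //; apply: IM.
apply: IHs; first exact: adjoin_ideal.
  apply: weakly_regular_ext WC => z; split=> [|/colP//].
  case=> u [a [Iu ->]]; rewrite mulrDl mulrAC; exists (u * m), (a * m); split=> //.
apply: weakly_regular_ext WA => z; split; exact: adjoinAC.
Qed.

(** Serves to pass from an ideal of the polynomial ring to the zero ideal of the quotient by it. *)
Lemma weakly_regular_morph (Q : comNzRingType) (f : {rmorphism R -> Q})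
    (I : Q -> Prop) s :
  (forall q, exists x, f x = q) ->
  weakly_regular (fun x => I (f x)) s -> weakly_regular I (map f s).
Proof.
move=> fsurj; elim: s I => //= y s IHs I [regy regs]; split=> [q|].
  by have [x <-] := fsurj q; rewrite -rmorphM; apply: regy.
apply: IHs; apply: weakly_regular_ext regs => x; split.
  by case=> u [a [Iu ->]]; exists (f u), (f a); rewrite rmorphD rmorphM.
case=> q [b [Iq fxE]]; have [a fa] := fsurj b.
exists (x - a * y), a; split; last by rewrite subrK.
by rewrite rmorphB rmorphM /= fa fxE addrK.
Qed.

Lemma regular_sequenceP s : weakly_regular (fun x => x = 0) s ->
  ~ seq_ideal s 1 -> regular_sequence s.
Proof.
move=> reg0 proper_s; split=> //.
(* The prefix [t] records the elements already absorbed into [I]: [weakly_regular] enlarges its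
   ideal at each step, while [regular_sequence] takes prefixes of one list. *)
suff: forall t I, (forall x, seq_ideal t x <-> I x) -> weakly_regular I s ->
  forall i y, (i < size s)%N ->
    seq_ideal (t ++ take i s) (s`_i * y) -> seq_ideal (t ++ take i s) y.
  by move/(_ [::] _ (@seq_ideal_nil R) reg0).
elim: s {reg0 proper_s} => // x s IHs t I tI [regx regs] [|i] y /=.
  by rewrite cats0 => _ /tI/regx/tI.
rewrite ltnS => lti; rewrite -cat_rcons; apply: IHs regs i y lti => z.
by rewrite seq_ideal_rcons; apply: adjoin_ext.
Qed.

End WeaklyRegular.

(** * Monomial ideals and polynomials in one of the variables *)

Lemma coefM_monic_ideal (R : comNzRingType) (I : R -> Prop) (G H : {poly R}) :
  is_ideal I -> G \is monic -> (forall j, I (G * H)`_j) -> forall j, I H`_j.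
Proof.
move=> idI monG IGH j; have [m] := ubnP (size H - j)%N.
elim: m j => // m IHm j ltm.
have [leHj|ltjH] := leqP (size H) j; first by rewrite nth_default //; case: idI.
pose e := (size G).-1.
have lte : (e < (j + e).+1)%N by rewrite ltnS leq_addl.
have := IGH (j + e)%N; rewrite coefM (bigD1 (Ordinal lte)) //= addnK.
have -> : G`_e = 1 by apply/monicP.
rewrite mul1r => Isum.
rewrite -[H`_j](addrK (\sum_(i < (j + e).+1 | i != Ordinal lte) G`_i * H`_(j + e - i))).
apply: ideal_sub => //; apply: ideal_big => // i; rewrite -val_eqE /= => ne_ie.
have [lt_ie|le_ei] := ltnP i e.
  by case: (idI) => _ _; apply; apply: IHm; lia.
rewrite (nth_default _ (_ : size G <= i)%N) ?mul0r; first by case: idI.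
by rewrite -(prednK (_ : 0 < size G)%N) ?size_poly_gt0 ?monic_neq0 // ltn_neqAle eq_sym ne_ie.
Qed.

Section PolynomialsInVariables.
Variables (k : fieldType) (n : nat).
Local Notation S := {mpoly k[n]}.
Implicit Types (I J : S -> Prop) (z : 'I_n) (g : {poly k}) (f : S).

Lemma mpoly_alg_ind (P : S -> Prop) :
  (forall c, P c%:MP) -> (forall i, P 'X_i) ->
  (forall p q, P p -> P q -> P (p + q)) ->
  (forall p q, P p -> P q -> P (p * q)) -> forall p, P p.
Proof.
move=> PC PX PD PM; apply: mpolyind => [|c m p _ _ Pp]; first exact: (PC 0).
apply: PD => //; rewrite -mul_mpolyC; apply: (PM) => //.
rewrite mpolyXE_id; apply: big_ind => [||i _]; first exact: (PC 1).
  by move=> x y Px Py; apply: (PM).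
by elim: (m i) => [|e IHe]; rewrite ?expr0 ?exprS; [exact: (PC 1)|apply: (PM)].
Qed.

(* Behind Qed because unification diverges when it unfolds [mmap]. *)
Lemma as_poly_subproof z : {f : {rmorphism S -> {poly S}} |
  (forall c, f c%:MP = (c%:MP)%:P) /\
  (forall i, f 'X_i = if i == z then 'X else ('X_i)%:P)}.
Proof.
exists (mmap (polyC \o @mpolyC n k) (fun i => if i == z then 'X else ('X_i)%:P)).
by split=> [c|i] /=; rewrite ?mmapC // mmapX mmap1U.
Qed.

(** The coefficients stay in [S] rather than in a ring with one variable fewer, so that they can be
    tested against the same ideal. *)
Definition as_poly z : {rmorphism S -> {poly S}} := sval (as_poly_subproof z).

Lemma as_polyX z i : as_poly z 'X_i = if i == z then 'X else ('X_i)%:P.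
Proof. exact: (proj2 (svalP (as_poly_subproof z))). Qed.

Lemma as_polyC z c : as_poly z c%:MP = (c%:MP)%:P.
Proof. exact: (proj1 (svalP (as_poly_subproof z))). Qed.

Lemma as_polyK z f : (as_poly z f).['X_z] = f.
Proof.
elim/mpoly_alg_ind: f => [c|i|p q Ep Eq|p q Ep Eq].
- by rewrite as_polyC hornerC.
- by rewrite as_polyX; case: eqP => [->|_]; rewrite ?hornerX ?hornerC.
- by rewrite rmorphD hornerD Ep Eq.
- by rewrite rmorphM hornerM Ep Eq.
Qed.

Definition poly_at (R : comNzRingType) (phi : {rmorphism k -> R}) g (x : R) : R :=
  (map_poly phi g).[x].

Lemma as_poly_at z i g :
  as_poly z (poly_at (@mpolyC n k) g 'X_i) =
  if i == z then map_poly (@mpolyC n k) g else (poly_at (@mpolyC n k) g 'X_i)%:P.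
Proof.
rewrite /poly_at -horner_map -map_poly_comp as_polyX.
have -> : map_poly (as_poly z \o @mpolyC n k) g = (map_poly (@mpolyC n k) g)^:P.
  by rewrite -map_poly_comp; apply: eq_map_poly => c /=; rewrite as_polyC.
case: eqP => _; last by rewrite horner_map.
exact: comp_polyXr.
Qed.

(** For an ideal this means being generated by polynomials in the variables other than [z]. *)
Definition free_of z I : Prop := forall f, I f -> forall j, I (as_poly z f)`_j.

Lemma free_of_adjoin z I b : is_ideal I ->
  as_poly z b = b%:P -> free_of z I -> free_of z (adjoin I b).
Proof.
move=> idI bE frI f [u [a [Iu ->]]] j; rewrite rmorphD rmorphM bE coefD coefMC.
by exists (as_poly z u)`_j, (as_poly z a)`_j; split=> //; apply: frI.
Qed.

(** Each element is monic in a variable that is free modulo the current ideal, hence a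
    non-zero-divisor by [coefM_monic_ideal]. It involves no other variable, so adjoining it leaves
    the remaining ones free. *)
Lemma weakly_regular_free (T : eqType) I (s : seq T) (v : T -> 'I_n) (g : T -> {poly k}) :
  is_ideal I -> uniq (map v s) -> (forall c, c \in s -> free_of (v c) I) ->
  (forall c, g c \is monic) ->
  weakly_regular I [seq poly_at (@mpolyC n k) (g c) 'X_(v c) | c <- s].
Proof.
move=> + + + mong; elim: s I => //= c s IHs I idI /andP[cNs uniq_s] frI; split.
  move=> f Icf; rewrite -(as_polyK (v c) f) horner_coef.
  apply: ideal_big => // j _; apply: ideal_mulr => //; move: (nat_of_ord j).
  apply: (coefM_monic_ideal idI (monic_map (@mpolyC n k) (mong c))) => l.
  by have:= frI c (mem_head _ _) _ Icf l; rewrite rmorphM as_poly_at eqxx.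
apply: IHs => //; first exact: adjoin_ideal.
move=> c' c's; apply: free_of_adjoin => //; last by apply: frI; rewrite inE c's orbT.
rewrite as_poly_at ifN //; apply: contraNneq cNs => ->; exact: map_f.
Qed.

Lemma free_of_zero z : free_of z (fun x => x = 0).
Proof. by move=> f -> j; rewrite rmorph0 coef0. Qed.

End PolynomialsInVariables.

(** * Monomial ideals given by their standard monomials *)

Section Coideals.
Variables (k : fieldType) (n : nat).
Local Notation S := {mpoly k[n]}.
Implicit Types (N : 'X_{1..n} -> Prop) (m v : 'X_{1..n}) (i : 'I_n) (f : S).

Definition downward_closed N : Prop := forall m m', (m <= m')%MM -> N m' -> N m.

(* For N downward closed, the monomial ideal whose standard monomials are N. *)
Definition coideal N : S -> Prop := fun f => forall m, N m -> f@_m = 0.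

Lemma coideal_is_ideal N : downward_closed N -> is_ideal (coideal N).
Proof.
move=> dN; split=> [m _|f g If Ig m Nm|a f If m Nm]; rewrite ?mcoeff0 //.
  by rewrite mcoeffD If ?Ig ?addr0.
apply/eqP; rewrite mcoeff_eq0; apply/negP => /msuppM_le/allpairsP[[m1 m2]] /= [_ m2f mE].
by move: m2f; rewrite mcoeff_msupp If ?eqxx //; apply: (dN _ m) => //; rewrite mE lem_addl.
Qed.

Lemma coidealX N m f : downward_closed N -> ~ N m -> coideal N (f * 'X_[m]).
Proof.
move=> dN NNm m' Nm'; apply/eqP; rewrite mcoeff_eq0 (perm_mem (msuppMX f m)).
by apply/negP => /mapP[m1 _ m'E]; apply/NNm/(dN _ m') => //; rewrite m'E lem_addr.
Qed.

(** The case of the monomial x^v in [weakly_regular_colon]: adding x^v to the ideal removes the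
    multiples of x^v from [N], and the colon by x^v translates [N] by [-v]. *)
Lemma weakly_regular_split N v s : downward_closed N ->
  weakly_regular (coideal (fun m => N m /\ ~~ (v <= m)%MM)) s ->
  weakly_regular (coideal (fun m => N (m + v)%MM)) s ->
  weakly_regular (coideal N) s.
Proof.
move=> dN regA regC; apply: (@weakly_regular_colon _ _ 'X_[v]).
- exact: coideal_is_ideal.
- apply: weakly_regular_ext regC => f; split=> If m Nm; last first.
    by rewrite -(mcoeffMX f v) addmC; apply: If.
  apply/eqP; rewrite mcoeff_eq0 (perm_mem (msuppMX f v)).
  apply/negP => /mapP[m1 m1f mE]; move: m1f.
  by rewrite mcoeff_msupp If ?eqxx // addmC -mE.
- apply: weakly_regular_ext regA => f; split; last first.
    case=> u [a [Iu ->]] m [Nm vm]; rewrite mcoeffD Iu // add0r; apply/eqP.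
    rewrite mcoeff_eq0 (perm_mem (msuppMX a v)); apply/negP => /mapP[m1 _ mE].
    by move: vm; rewrite mE lem_addr.
  move=> If; exists (\sum_(m <- msupp f | ~~ (v <= m)%MM) f@_m *: 'X_[m]).
  exists (\sum_(m <- msupp f | (v <= m)%MM) f@_m *: 'X_[m - v]); split.
    apply: ideal_big => [|m vm m' Nm']; first exact: coideal_is_ideal.
    rewrite mcoeffZ mcoeffX; case: eqP => [mE|_]; last by rewrite mulr0.
    by rewrite mE in vm *; rewrite If ?mul0r.
  rewrite mulr_suml {1}[f]mpolyE (bigID (fun m => v <= m)%MM) /= addrC; congr (_ + _).
  by apply: eq_bigr => m vm; rewrite -scalerAl -mpolyXD submK.
Qed.

Lemma coideal_ext N N' f : (forall m, N m <-> N' m) -> coideal N f -> coideal N' f.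
Proof. by move=> NN' If m /NN'/If. Qed.

(** An iterated [adjoin], so that [free_of_adjoin] applies one variable at a time. *)
Definition vars_ideal (s : seq 'I_n) : S -> Prop :=
  foldr (fun i I => adjoin I 'X_i) (fun f => f = 0) s.

Lemma vars_ideal_is_ideal s : is_ideal (vars_ideal s).
Proof. by elim: s => [|i s IHs]; [exact: zero_ideal | exact: adjoin_ideal]. Qed.

Lemma mem_vars_ideal s i : i \in s -> vars_ideal s 'X_i.
Proof.
elim: s => //= j s IHs; rewrite inE => /predU1P[->|/IHs].
  exact/mem_adjoin/vars_ideal_is_ideal.
exact: sub_adjoin.
Qed.

Lemma free_of_vars_ideal s z : z \notin s -> free_of z (vars_ideal s).
Proof.
elim: s => [_|i s IHs]; first exact: free_of_zero.
rewrite inE negb_or => /andP[ne_zi zNs]; apply: free_of_adjoin.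
- exact: vars_ideal_is_ideal.
- by rewrite as_polyX eq_sym (negPf ne_zi).
- exact: IHs.
Qed.

Lemma coideal_face (F : {set 'I_n}) f :
  coideal (fun m => forall i, i \notin F -> m i = 0%N) f <-> vars_ideal (enum (~: F)) f.
Proof.
have dN : downward_closed (fun m => forall i, i \notin F -> m i = 0%N).
  by move=> m m' /mnm_lepP lemm' Nm' i /Nm' m'i0; apply/eqP; rewrite -leqn0 -m'i0.
split=> [If|].
  rewrite [f]mpolyE big_seq; apply: ideal_big => [|m]; first exact: vars_ideal_is_ideal.
  rewrite mcoeff_msupp => fm.
  have /existsP[i /andP[iNF mi]]: [exists i, (i \notin F) && (m i != 0%N)].
    apply: contraNT fm => /existsPn noi; apply/eqP/If => i iNF.
    by have:= noi i; rewrite iNF negbK => /eqP.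
  have idV := vars_ideal_is_ideal (enum (~: F)).
  rewrite -(submK (_ : U_(i) <= m)%MM) ?lep1mP // mpolyXD scalerAl.
  by case: (idV) => _ _; apply; apply: mem_vars_ideal; rewrite mem_enum inE.
have: {subset enum (~: F) <= ~: F} by move=> i; rewrite mem_enum.
have idN := coideal_is_ideal dN.
elim: (enum _) f => [|i s IHs] f sF /=; first by move->; case: idN.
apply: adjoin_min => // [z|].
  by apply: IHs => j js; apply: sF; rewrite inE js orbT.
rewrite -[U_(i)%MM]add0m mpolyXD; apply: coidealX => // /(_ i).
have:= sF i (mem_head _ _); rewrite inE => iNF /(_ iNF).
by rewrite mnm1E eqxx.
Qed.

(** Modulo the variables outside [F], each [theta c] is the single variable [v c], so
    [weakly_regular_free] applies after a congruence. *)
Lemma weakly_regular_face (F : {set 'I_n}) (T : eqType) (s : seq T)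
    (v : T -> 'I_n) (theta : T -> S) (g : T -> {poly k}) :
  uniq (map v s) -> (forall c, c \in s -> v c \in F) ->
  (forall c, c \in s ->
     coideal (fun m => forall i, i \notin F -> m i = 0%N) (theta c - 'X_(v c))) ->
  (forall c, g c \is monic) ->
  weakly_regular (coideal (fun m => forall i, i \notin F -> m i = 0%N))
    [seq poly_at (@mpolyC n k) (g c) (theta c) | c <- s].
Proof.
move=> uniq_s vF thE mong; have idV := vars_ideal_is_ideal (enum (~: F)).
apply: (weakly_regular_ext (I := vars_ideal (enum (~: F)))).
  by move=> z; symmetry; apply: coideal_face.
apply: weakly_regular_congr (weakly_regular_free idV uniq_s _ mong) => //.
- by rewrite !size_map.
- move=> i; rewrite size_map => lti; case: s lti uniq_s vF thE => // c0 s0.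
  set s := c0 :: s0 => lti uniq_s vF thE.
  rewrite !(nth_map c0) //; set c := nth c0 s i.
  have cs : c \in s by apply: mem_nth.
  (* Congruent arguments give congruent values, since a difference of j-th powers is a multiple of
     the difference. *)
  rewrite /poly_at !horner_coef -sumrB; apply: ideal_big => // j _.
  rewrite -mulrBr -opprB subrXX; case: (idV) => _ _ VM; apply: VM.
  apply: ideal_opp => //; apply: ideal_mulr => //.
  by apply/coideal_face/thE.
- by move=> c cs; apply: free_of_vars_ideal; rewrite mem_enum inE negbK vF.
Qed.

End Coideals.

(** * Clique trees *)

Section Bridges.
Variables (W : finType) (e : rel W).

Definition remove_edge (x y : W) : rel W := fun u v =>
  e u v && ~~ (((u == x) && (v == y)) || ((u == y) && (v == x))).

(** A simple path from [x] to [y] in the remaining graph is closed by the edge to a cycle.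
    Acyclicity leaves only the path of one step, which is the removed edge itself. *)
Lemma acyclic_bridge x y : ssrbool.symmetric e -> acyclic e -> e x y -> x != y ->
  ~~ connect (remove_edge x y) x y.
Proof.
move=> sym_e acyc exy ne_xy; apply/negP => /connectP[p0 path_p0 yE].
case/shortenP: path_p0 yE => p path_p uniq_p _ yE {p0}.
have path_e : path e x p by apply: sub_path path_p => u v /andP[].
have := acyc (x :: p); rewrite /ucycle /= rcons_path path_e -yE sym_e exy.
move/(_ uniq_p); case: p yE path_p {uniq_p path_e} => [|z [|//]] /=.
  by move=> xy; rewrite xy eqxx in ne_xy.
by move=> ->; rewrite /remove_edge !eqxx andbF.
Qed.

End Bridges.

Section Complexes.
Variable n : nat.
Implicit Types (D : {set {set 'I_n}}) (s F G L : {set 'I_n}).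

Definition pure_of_size D m : Prop :=
  simplicial_complex D /\ {in facets D, forall F, #|F| = m}.

Lemma facet_mem D F : F \in facets D -> F \in D.
Proof. by rewrite inE => /maxsetP[]. Qed.

Lemma mem_star D i F : (F \in [set G in facets D | i \in G]) = (F \in facets D) && (i \in F).
Proof. by rewrite in_set. Qed.

Lemma face_sub_facet D s : s \in D -> exists2 F, F \in facets D & s \subset F.
Proof.
by move=> Ds; have [F Fmax sF] := maxset_exists (P := mem D) Ds; exists F; rewrite ?inE.
Qed.

Lemma face_sub D s F : simplicial_complex D -> s \subset F -> F \in D -> s \in D.
Proof. by case=> _ subD _; apply: subD. Qed.

Lemma facet_exists D : simplicial_complex D -> exists F, F \in facets D.
Proof. by case=> /set0Pn[s /face_sub_facet[F FD _]]; exists F. Qed.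

Lemma pure_max_face_size D m : pure_of_size D m -> max_face_size D = m.
Proof.
case=> cxD sizeD; have [F FD] := facet_exists cxD; apply/eqP.
rewrite eqn_leq; apply/andP; split.
  apply/bigmax_leqP => s /face_sub_facet[G GD sG].
  by rewrite -(sizeD G GD) subset_leq_card.
rewrite -(sizeD F FD).
exact: (@leq_bigmax_cond _ (mem D) (fun s : {set 'I_n} => #|s|) F (facet_mem FD)).
Qed.

Lemma pure_dim D d : simplicial_complex D -> pure D -> cx_dim D = d%:Z - 1 ->
  pure_of_size D d.
Proof.
move=> cxD pureD dimD; split=> // F FD.
suff sizeD : pure_of_size D #|F|.
  have := pure_max_face_size sizeD; move: dimD; rewrite /cx_dim => /addIr[->] //.
by split=> // G GD; apply: pureD.
Qed.

Lemma facet_of_size D m F : pure_of_size D m -> F \in D -> #|F| = m -> F \in facets D.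
Proof.
case=> cxD sizeD FD sF; have [G GD FG] := face_sub_facet FD.
by rewrite (_ : F = G) //; apply/eqP; rewrite eqEcard FG (sizeD G GD) sF leqnn.
Qed.

End Complexes.

(** * Edges of a clique tree and the non-faces they carry *)

Section CliqueTree.
Variables (n m : nat) (D : {set {set 'I_n}}) (T : rel {set 'I_n}).
Hypotheses (pureD : pure_of_size D m) (treeT : clique_tree D T) (lt_mn : (m < n)%N).
Implicit Types (F G H L s : {set 'I_n}) (i p q : 'I_n).

Let symT : ssrbool.symmetric T. Proof. by case: treeT => -[]. Qed.
Let cxD : simplicial_complex D. Proof. by case: pureD. Qed.

Lemma edge_facets F G : T F G ->
  [/\ F \in facets D, G \in facets D, F != G & #|F :&: G|.+1 = m].
Proof.
case: treeT => -[_ subT _ _] _ /subT /and4P[FD GD neFG /eqP sFG]; split=> //.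
by rewrite sFG (pure_max_face_size pureD).
Qed.

Lemma edge_union_size F G : T F G -> #|F :|: G| = m.+1.
Proof.
move=> /edge_facets[FD GD _ sI]; have := cardsUI F G.
by case: pureD => _ sz; rewrite (sz F) // (sz G) //; lia.
Qed.

Lemma edge_pair F G : T F G -> exists p q,
  [/\ p != q, p \in F, q \in G, F = (F :|: G) :\ q & G = (F :|: G) :\ p].
Proof.
move=> TFG; have [FD GD _ sI] := edge_facets TFG; case: pureD => _ sz.
have /eqP/cards1P[p FGp] : #|F :\: G| = 1%N by rewrite cardsD sz // -sI subSnn.
have /eqP/cards1P[q GFq] : #|G :\: F| = 1%N by rewrite cardsD sz // setIC -sI subSnn.
have /setP FGE := FGp; have /setP GFE := GFq.
have := FGE p; have := GFE q; rewrite !inE !eqxx => /andP[qF qG] /andP[pG pF].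
exists p, q; split=> //.
- by apply: contraNneq pG => ->.
- apply/setP => i; have := GFE i; rewrite !inE.
  by case: eqP => [->|_]; [rewrite (negPf qF)|case: (i \in F) => //= ->].
- apply/setP => i; have := FGE i; rewrite !inE.
  by case: eqP => [->|_]; [rewrite (negPf pG)|case: (i \in G) => //=; rewrite ?orbT // orbF => ->].
Qed.

(** The facets containing [i] span a connected subgraph of the tree, and an edge with an end that
    misses [i] is not in that subgraph, so deleting it does no harm. *)
Lemma star_connect i F G X Y : X \in facets D -> Y \in facets D ->
  i \in X -> i \in Y -> (i \notin F) || (i \notin G) ->
  connect (remove_edge T F G) X Y.
Proof.
move=> XD YD iX iY iFG; case: treeT => _ /(_ i X Y).
rewrite !mem_star XD YD iX iY => /(_ isT isT); apply: connect_sub => U V /=.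
rewrite !mem_star => /and3P[/andP[_ iU] /andP[_ iV] TUV]; apply: connect1.
rewrite /remove_edge TUV negb_or /=; apply/andP; split; apply/negP => /andP[/eqP UE /eqP VE].
  by move: iFG; rewrite -UE -VE iU iV.
by move: iFG; rewrite -UE -VE iU iV.
Qed.

Lemma edge_bridge F G : T F G -> ~~ connect (remove_edge T F G) F G.
Proof.
move=> TFG; have [_ _ neFG _] := edge_facets TFG.
by apply: acyclic_bridge => //; case: treeT => -[].
Qed.

(** A facet [H] containing both [p] and [q] would link [F] to [H] through [p] and [H] to [G] through
    [q], going around the bridge [F G]. *)
Lemma edge_nonface F G p q : T F G -> p \in F -> p \notin G -> q \in G ->
  q \notin F -> [set p; q] \notin D.
Proof.
move=> TFG pF pG qG qF; have [FD GD _ _] := edge_facets TFG.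
apply: contra (edge_bridge TFG) => /face_sub_facet[H HD].
rewrite subUset !sub1set => /andP[pH qH].
by apply: (connect_trans (y := H)); [apply: (@star_connect p)|apply: (@star_connect q)];
  rewrite // ?pG ?qF ?orbT.
Qed.

Lemma edge_pair_nonface F G : T F G -> exists p q,
  [/\ p \in F, p \notin G, q \in G, q \notin F &
   [/\ p != q, F = (F :|: G) :\ q, G = (F :|: G) :\ p & [set p; q] \notin D]].
Proof.
move=> TFG; have [p [q [ne_pq pF qG FE GE]]] := edge_pair TFG.
have pG : p \notin G by rewrite GE !inE eqxx.
have qF : q \notin F by rewrite FE !inE eqxx.
by exists p, q; split=> //; split=> //; apply: edge_nonface pF pG qG qF.
Qed.

(** As [m < n], some vertex lies outside [F], hence there is another facet; the tree path towards it
    starts with an edge at [F]. *)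
Lemma facet_edge F : F \in facets D -> exists G, T F G.
Proof.
move=> FD; case: pureD => _ /(_ F FD) sF.
have [i iF] : exists i, i \notin F.
  apply/existsP; apply: contraTT lt_mn => /existsPn Ffull; rewrite -leqNgt -sF.
  by rewrite -[n in (n <= _)%N]card_ord; apply/subset_leq_card/subsetP => i _; rewrite -[_ \in _]negbK.
have [G GD iG] : exists2 G, G \in facets D & i \in G.
  by case: cxD => _ _ /(_ i)/face_sub_facet[G GD]; rewrite sub1set; exists G.
case: treeT => -[_ _ connT _] _; have /connectP[[|H r] /=] := connT F G FD GD.
  by move=> _ GF; rewrite -GF iG in iF.
by case/andP=> /and3P[_ _ TFH] _ _; exists H.
Qed.

Lemma mem_edge_union L : L \in edge_union_complex T <->
  exists F G, T F G /\ L \subset F :|: G.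
Proof.
rewrite inE; split; first by case/existsP=> F /existsP[G /andP[]]; exists F, G.
by case=> F [G [TFG sL]]; apply/existsP; exists F; apply/existsP; exists G; rewrite TFG.
Qed.

Lemma face_edge_union L : L \in D -> L \in edge_union_complex T.
Proof.
move=> /face_sub_facet[F /facet_edge[G TFG] sLF]; apply/mem_edge_union.
by exists F, G; rewrite TFG subsetU // sLF.
Qed.

Lemma edge_union_facet F : F \in facets (edge_union_complex T) ->
  exists G H, T G H /\ F = G :|: H.
Proof.
move=> Fmax; have /mem_edge_union[G [H [TGH sF]]] := facet_mem Fmax; exists G, H; split=> //.
move: Fmax; rewrite inE => /maxsetP[_ maxF]; symmetry; apply: maxF => //.
by apply/mem_edge_union; exists G, H.
Qed.

Lemma edge_union_pure : pure_of_size (edge_union_complex T) m.+1.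
Proof.
split; last by move=> F /edge_union_facet[G [H [TGH ->]]]; apply: edge_union_size.
case: (cxD) => D0 _ D1; split=> [|s F sF /mem_edge_union[G [H [TGH sFGH]]]|i].
- by case/set0Pn: D0 => s /face_edge_union sD; apply/set0Pn; exists s.
- by apply/mem_edge_union; exists G, H; split=> //; apply: subset_trans sFGH.
- exact: face_edge_union.
Qed.

Lemma edge_nonface_notin s : s \in edge_nonfaces D T -> s \notin D.
Proof. by rewrite !inE => /andP[/minsetP[]]. Qed.

(** A non-face under [F :|: G] fits into neither [F] nor [G], each of which misses just one element
    of the union, so it contains both [p] and [q]. Since these already form a non-face, minimality
    leaves nothing else. *)
Lemma edge_nonfaceP s : s \in edge_nonfaces D T -> exists F G p q,
  [/\ T F G, p \in F, p \notin G, q \in G & q \notin F] /\ s = [set p; q].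
Proof.
rewrite !inE => /andP[/minsetP[sND mins] /existsP[F /existsP[G /andP[TFG sFG]]]].
have [p [q [pF pG qG qF [ne_pq FE GE pqND]]]] := edge_pair_nonface TFG.
have [FD GD _ _] := edge_facets TFG.
have sD E i : E \in D -> E = (F :|: G) :\ i -> i \in s.
  move=> ED EE; apply: contraR sND => iNs; apply: face_sub ED => //.
  by rewrite EE subsetD1 sFG.
exists F, G, p, q; split=> //; symmetry; apply: mins => //.
by rewrite subUset !sub1set (sD G p (facet_mem GD) GE) (sD F q (facet_mem FD) FE).
Qed.

Lemma pair_min_nonface p q : p != q -> [set p; q] \notin D -> [set p; q] \in min_nonfaces D.
Proof.
move=> ne_pq pqND; rewrite inE; apply/minsetP; split=> // s /= sND ss.
case: (cxD) => _ subD D1; apply/eqP; rewrite eqEsubset ss subUset !sub1set /=.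
apply/andP; split; apply/negPn/negP => iNs; case/negP: sND.
  apply: subD (D1 q); apply/subsetP => j js.
  have := subsetP ss j js; rewrite !inE => /orP[/eqP jE|//].
  by rewrite -jE js in iNs.
apply: subD (D1 p); apply/subsetP => j js.
have := subsetP ss j js; rewrite !inE => /orP[//|/eqP jE].
by rewrite -jE js in iNs.
Qed.

Lemma nonface_edge_nonface L : L \in edge_union_complex T -> L \notin D ->
  exists2 s, s \in edge_nonfaces D T & s \subset L.
Proof.
move=> LT LD; have [s smin sL] := minset_exists (P := fun u => u \notin D) LD.
exists s => //; rewrite !inE smin; have /mem_edge_union[F [G [TFG LFG]]] := LT.
by apply/existsP; exists F; apply/existsP; exists G; rewrite TFG (subset_trans sL).
Qed.

Lemma edge_nonface_ends p q : p != q -> [set p; q] \in edge_nonfaces D T ->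
  exists F G, [/\ T F G, p \in F, p \notin G, q \in G & q \notin F].
Proof.
move=> ne_pq /edge_nonfaceP[F [G [a [b [[TFG aF aG bG bF] /setP pqE]]]]].
have := pqE p; have := pqE q; rewrite !inE !eqxx orbT /= => qab pab.
case/esym/pred2P: pab => pE; case/esym/pred2P: qab => qE; rewrite pE qE ?eqxx // in ne_pq *.
  by exists F, G; split.
by exists G, F; rewrite symT; split.
Qed.

Lemma edge_diff F G p q : T F G -> p \in F -> q \in F -> p \notin G -> q \notin G -> p = q.
Proof.
move=> TFG pF qF pG qG; have [a [b [_ _ _ _ GE]]] := edge_pair TFG.
by move: pG qG; rewrite GE !inE pF qF !andbT !negbK => /eqP-> /eqP->.
Qed.

(** Let [F F'] and [H H'] be edges giving the two pairs. If [q] and [s] lay under one edge, a walk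
    from [F] to [H] through [p], across [H H'], then along facets containing [s] and facets
    containing [q], would reach [F'] without the bridge [F F']. *)
Lemma edge_nonface_triangle (p q s : 'I_n) : q != s -> p != q -> p != s ->
  [set p; q] \in edge_nonfaces D T -> [set p; s] \in edge_nonfaces D T ->
  [set q; s] \notin edge_union_complex T.
Proof.
move=> ne_qs ne_pq ne_ps /(edge_nonface_ends ne_pq)[F [F' [TF pF pF' qF' qF]]].
move=> /(edge_nonface_ends ne_ps)[H [H' [TH pH pH' sH' sH]]].
have [FD F'D _ _] := edge_facets TF; have [HD H'D _ _] := edge_facets TH.
have FH : connect (remove_edge T F F') F H by apply: (@star_connect p); rewrite ?pF' ?orbT.
have qH : q \notin H.
  apply: contra (edge_bridge TF) => qH; apply: connect_trans FH _.
  by apply: (@star_connect q); rewrite ?qF.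
have sF : s \notin F.
  apply: contra (edge_bridge TH) => sF; apply: (connect_trans (y := F)).
    by apply: (@star_connect p); rewrite ?pH' ?orbT.
  by apply: (@star_connect s); rewrite ?sH.
apply: contra (edge_bridge TF) => /mem_edge_union[G [G' [TG]]].
rewrite subUset !sub1set !inE => /andP[qGG sGG].
have [X [Y [XD YD qX sY XY]]] : exists X Y, [/\ X \in facets D, Y \in facets D,
    q \in X, s \in Y & (X == Y) || T Y X].
  have [GD G'D _ _] := edge_facets TG; case/orP: qGG => qG; case/orP: sGG => sG.
  - by exists G, G; rewrite eqxx.
  - by exists G, G'; rewrite symT TG orbT.
  - by exists G', G; rewrite TG orbT.
  - by exists G', G'; rewrite eqxx.
apply: connect_trans FH _; apply: (connect_trans (y := H')).
  apply: connect1; rewrite /remove_edge TH negb_or /=; apply/andP; split; apply/negP.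
    (* [H H'] is not the deleted edge: otherwise [q] and [s] would both be the only vertex of [F']
       outside [F]. *)
    case/andP => /eqP HF /eqP HF'; move/eqP: ne_qs; apply.
    by apply: (@edge_diff F' F) => //; [rewrite symT | rewrite -HF'].
  by case/andP => _ /eqP H'F; rewrite H'F (negPf sF) in sH'.
apply: (connect_trans (y := Y)); first by apply: (@star_connect s); rewrite ?sF.
apply: (connect_trans (y := X)); last by apply: (@star_connect q); rewrite ?qF.
case/orP: XY => [/eqP->//|TYX]; apply: connect1; rewrite /remove_edge TYX negb_or /=.
apply/andP; split; apply/negP => /andP[/eqP YE /eqP XE].
  by rewrite YE (negPf sF) in sY.
by rewrite XE (negPf qF) in qX.
Qed.

End CliqueTree.

(** * Standard monomials of the clique tree ideal *)

Section Balanced.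
Variables (n d : nat) (D : {set {set 'I_n}}).
Hypotheses (treeD : tree_complex D) (pureD : pure_of_size D d).

(** By the dimension condition some face shared with an earlier facet has [d - 1] elements. It
    avoids the new vertex [j], so it is all of the facet but [j]. *)
Lemma shelling_attaching_face (fs : seq {set 'I_n}) i j :
  shelling D fs -> (0 < i < size fs)%N -> j \in nth set0 fs i ->
  j \notin \bigcup_(F <- take i fs) F ->
  exists2 F, F \in take i fs & nth set0 fs i :\ j \subset F.
Proof.
move=> [uniq_fs fsE shell] lti jF jN; have [_ dimE] := shell i lti.
have /andP[i_gt0 ltis] := lti.
have sF : #|nth set0 fs i| = d by case: pureD => _; apply; rewrite -fsE mem_nth.
have jNF F : F \in take i fs -> j \notin F.
  move=> Ffs; apply: contra jN => jF'.
  by rewrite (big_rem F) //= inE jF'.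
have E0 : (0 < #|earlier_faces fs i|)%N.
  apply/card_gt0P; exists set0; rewrite inE sub0set; apply/hasP.
  exists (nth set0 fs 0); last exact: sub0set.
  by rewrite -(nth_take _ i_gt0) mem_nth // size_take ltis.
have [s sE maxE] := eq_bigmax_cond (fun s : {set 'I_n} => #|s|) E0.
have {maxE} ss : #|s| = d.-1.
  move: dimE; rewrite /cx_dim (pure_max_face_size pureD) => dimE.
  have : max_face_size (earlier_faces fs i) = #|s| by [].
  have : (0 < d)%N by rewrite -sF; apply/card_gt0P; exists j.
  by move: dimE; lia.
move: sE; rewrite inE => /andP[sF' /hasP[F Ffs sFl]]; exists F => //.
suff <- : s = nth set0 fs i :\ j by [].
have js : j \notin s by apply: contra (jNF F Ffs); apply: (subsetP sFl).
apply/eqP; rewrite eqEcard subsetD1 sF' js /=.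
by rewrite ss -sF [X in (_ <= X.-1)%N](cardsD1 j) jF.
Qed.

(** Induction along the shelling: all vertices of the next facet but the new one lie in one earlier
    facet, so they carry [d - 1] distinct colours, and the new vertex takes the remaining one. *)
Lemma balanced_coloring :
  exists col : 'I_n -> 'I_d, forall F, F \in facets D -> {in F &, injective col}.
Proof.
have [cxD sizeD] := pureD.
(* For [d = 0] the facets are empty, yet every vertex lies in a facet, so there is nothing to
   colour. *)
have [d0|d_gt0] := posnP d.
  have noI (i : 'I_n) : False.
    case: cxD => _ _ /(_ i)/face_sub_facet[F /sizeD]; rewrite d0 => /cards0_eq ->.
    by rewrite sub1set inE.
  by exists (fun i => False_rect _ (noI i)) => F _ i; case: (noI i).
case: treeD => _ _ [fs shell new]; have [uniq_fs fsE _] := shell.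
suff: forall i, (i <= size fs)%N -> exists col : 'I_n -> 'I_d,
    forall F, F \in take i fs -> {in F &, injective col}.
  by case/(_ _ (leqnn _)) => col; rewrite take_size => Hcol; exists col => F; rewrite -fsE; apply: Hcol.
elim=> [|i IHi] lti; first by exists (fun _ => Ordinal d_gt0) => F; rewrite take0.
have [col Hcol] := IHi (ltnW lti); set F := nth set0 fs i.
have FD : F \in facets D by rewrite -fsE mem_nth.
have sF := sizeD F FD.
have [i0|i_gt0] := posnP i.
  exists (fun x => insubd (Ordinal d_gt0) (index x (enum F))).
  have t0 : take i fs = [::] by rewrite i0 take0.
  move=> G; rewrite (take_nth set0) // t0 /= inE => /eqP->.
  have valE x : x \in F -> val (insubd (Ordinal d_gt0) (index x (enum F))) = index x (enum F).
    move=> xF; rewrite val_insubd /= ifT // -sF cardE index_mem mem_enum //.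
  move=> x y xF yF /(congr1 val); rewrite !valE // => exy.
  have yE : y \in enum F by rewrite mem_enum.
  have xE : x \in enum F by rewrite mem_enum.
  by rewrite -(nth_index x xE) exy nth_index.
have [j jF jN] := new i (etrans (congr2 andb i_gt0 lti) erefl).
have [G Gfs FjG] := shelling_attaching_face shell (etrans (congr2 andb i_gt0 lti) erefl) jF jN.
have [c cN] : exists c, c \notin col @: (F :\ j).
  apply/existsP; apply: contraTT (leq_imset_card col (F :\ j)) => /existsPn full.
  rewrite -ltnNge (_ : col @: _ = setT) ?cardsT ?card_ord; last first.
    by apply/setP => c; rewrite [RHS]inE -[LHS]negbK full.
  by rewrite -sF [X in (_ < X)%N](cardsD1 j) jF.
have jNF H : H \in take i fs -> j \notin H.
  move=> Hfs; apply: contra jN => jH.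
  by rewrite (big_rem H) //= inE jH.
exists (fun x => if x == j then c else col x) => H.
rewrite (take_nth set0) // mem_rcons inE => /predU1P[->|Hfs] x y.
  have colN z : z \in F -> z != j -> c <> col z.
    move=> zF zj cE; case/negP: cN; apply/imsetP; exists z => //.
    by rewrite !inE zj.
  move=> xF yF; case: (eqVneq x j) => [->|xj]; case: (eqVneq y j) => [->|yj] //.
  - by move=> /colN; case.
  - by move/esym/colN; case.
  - by apply: (Hcol G Gfs); apply: (subsetP FjG); rewrite !inE ?xj ?yj.
move=> xH yH; rewrite !ifN; first exact: (Hcol H Hfs).
  by apply: contraNneq (jNF H Hfs) => <-.
by apply: contraNneq (jNF H Hfs) => <-.
Qed.

End Balanced.

(** * Allowing bounded exponents in one more variable *)

Section Thicken.
Variables (k : fieldType) (n : nat).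
Implicit Types (N : 'X_{1..n} -> Prop) (m : 'X_{1..n}) (q : 'I_n).

Definition mnm_drop q m : 'X_{1..n} := [multinom if i == q then 0%N else m i | i < n].

Lemma mnm_dropE q m i : mnm_drop q m i = if i == q then 0%N else m i.
Proof. exact: mnmE. Qed.

Lemma mul_mnm1_le q c m : (U_(q) *+ c <= m)%MM = (c <= m q)%N.
Proof.
apply/mnm_lepP/idP => [/(_ q)|cm i]; first by rewrite mulmnE mnm1E eqxx mul1n.
by rewrite mulmnE mnm1E; case: eqP => [<-|_]; rewrite ?mul1n.
Qed.

Lemma weakly_regular_coideal_ext N N' (s : seq {mpoly k[n]}) :
  (forall m, N m <-> N' m) ->
  weakly_regular (coideal N) s -> weakly_regular (coideal N') s.
Proof.
move=> NN'; apply: weakly_regular_ext => f.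
by split; apply: coideal_ext => m; [|symmetry].
Qed.

(** The new set is a union of [c] translates of [N] by powers of x_q. They are split off one at a
    time, the one with the highest power first. *)
Lemma weakly_regular_thicken N q c (s : seq {mpoly k[n]}) :
  downward_closed N -> (forall m, N m -> m q = 0%N) ->
  weakly_regular (coideal N) s ->
  weakly_regular (coideal (fun m => (m q < c)%N /\ N (mnm_drop q m))) s.
Proof.
move=> dN N0 regN.
have dT c' : downward_closed (fun m => (m q < c')%N /\ N (mnm_drop q m)).
  move=> m m' /mnm_lepP le_mm' [ltc Nm']; split; first exact: leq_ltn_trans ltc.
  apply: dN Nm'; apply/mnm_lepP => i; rewrite !mnm_dropE; case: ifP => // _.
elim: c => [|c IHc].
  (* For [c = 0] no monomial is standard and the ideal is the unit ideal. *)
  by apply: weakly_regular_unit; [exact: coideal_is_ideal | move=> m []].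
apply: (@weakly_regular_split _ _ _ (U_(q) *+ c)%MM) => //.
  apply: weakly_regular_coideal_ext IHc => m; rewrite mul_mnm1_le -ltnNge ltnS.
  by split=> [[ltc Nm]|[[_ Nm] ltc]]; split=> //; split=> //; apply: ltnW.
apply: weakly_regular_coideal_ext regN => m.
rewrite mnmDE mulmnE mnm1E eqxx mul1n ltnS -{2}[c]add0n leq_add2r leqn0.
have dropE : m q = 0%N -> mnm_drop q (m + U_(q) *+ c)%MM = m.
  move=> mq; apply/mnmP => i; rewrite mnm_dropE; case: eqVneq => [->//|ne_iq].
  by rewrite mnmDE mulmnE mnm1E eq_sym (negPf ne_iq) addn0.
split=> [Nm|[/eqP mq]]; last by rewrite dropE.
by have mq := N0 m Nm; rewrite dropE // mq.
Qed.

End Thicken.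

(** * The increasing tower of complexes and its standard monomials *)

Section IteratedCliqueTree.
Variables (n d : nat) (D : {set {set 'I_n}}).
Variables (Ds : nat -> {set {set 'I_n}}) (Ts : nat -> rel {set 'I_n}).
Hypotheses (pureD : pure_of_size D d) (itD : iterated_clique_tree D d Ds Ts).
Local Notation w := (n - d)%N.
Local Notation Sigma t := (edge_nonfaces (Ds t) (Ts t)).
Implicit Types (t r : nat) (L F G : {set 'I_n}) (p q i : 'I_n) (m b : 'X_{1..n}).

Lemma Ds_treeP t : (t < w)%N -> clique_tree (Ds t) (Ts t).
Proof. by case: itD => _ H /H[]. Qed.

Lemma Ds_succ t : (t < w)%N -> Ds t.+1 = edge_union_complex (Ts t).
Proof. by case: itD => _ H /H[]. Qed.

Lemma facet_size_le : (d <= n)%N.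
Proof.
case: pureD => cxD sz; have [F /sz <-] := facet_exists cxD.
by rewrite -[n in (_ <= n)%N]card_ord max_card.
Qed.

Lemma Ds_pure t : (t <= w)%N -> pure_of_size (Ds t) (d + t).
Proof.
elim: t => [_|t IHt lttw]; first by case: itD => -> _; rewrite addn0.
rewrite Ds_succ // addnS; apply: (edge_union_pure (IHt (ltnW lttw))).
  exact: Ds_treeP.
by lia.
Qed.

Lemma Ds_full : [set: 'I_n] \in Ds w.
Proof.
have [cxw szw] := Ds_pure (leqnn _); have [F FD] := facet_exists cxw.
suff -> : setT = F by apply: facet_mem.
apply/esym/eqP; rewrite eqEcard subsetT cardsT card_ord (szw F FD) /=.
by rewrite subnKC // facet_size_le.
Qed.

Lemma Ds_sub t r L : (t <= r <= w)%N -> L \in Ds t -> L \in Ds r.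
Proof.
elim: r => [|r IHr]; first by rewrite leqn0 => /andP[/eqP->].
rewrite leq_eqVlt => /andP[/orP[/eqP->//|lt_tr] lt_rw] Lt; rewrite Ds_succ //.
apply: (face_edge_union (Ds_pure (ltnW lt_rw)) (Ds_treeP lt_rw)); first by lia.
by apply: IHr => //; rewrite -ltnS lt_tr ltnW.
Qed.

(** Every set is a face of the last complex, so [L] becomes a face at some step from [Ds r] to
    [Ds r.+1]; there [nonface_edge_nonface] supplies a pair. *)
Lemma Ds_nonface t L : (t <= w)%N -> L \notin Ds t ->
  exists r s, [/\ (t <= r < w)%N, s \in Sigma r & s \subset L].
Proof.
move=> letw; have [j tjw] : exists j, (t + j)%N = w by exists (w - t)%N; rewrite subnKC.
elim: j t tjw {letw} => [|j IHj] t tjw LN.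
  case/negP: LN; rewrite -[t]addn0 tjw.
  by apply: face_sub Ds_full; [case: (Ds_pure (leqnn _))|apply: subsetT].
have lttw : (t < w)%N by rewrite -tjw addnS ltnS leq_addr.
have [Lt1|Lt1] := boolP (L \in Ds t.+1).
  rewrite Ds_succ // in Lt1; have [s ss sL] := nonface_edge_nonface Lt1 LN.
  by exists t, s; rewrite leqnn.
rewrite addnS -addSn in tjw; have [r [s [/andP[ltr lrw] ss sL]]] := IHj _ tjw Lt1.
by exists r, s; rewrite (ltnW ltr).
Qed.

Lemma Sigma_nonface t r s : (t <= r < w)%N -> s \in Sigma r -> s \notin Ds t.
Proof.
move=> /andP[letr lerw] /edge_nonface_notin; apply: contra; apply: Ds_sub.
by rewrite letr ltnW.
Qed.

Lemma Sigma_pair t s : (t < w)%N -> s \in Sigma t ->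
  exists p q, p != q /\ s = [set p; q].
Proof.
move=> lttw /(edge_nonfaceP (Ds_pure (ltnW lttw)) (Ds_treeP lttw)).
case=> [F [G [p [q [[_ pF pG qG qF] ->]]]]]; exists p, q; split=> //.
by apply: contraNneq pG => ->.
Qed.

(** A pair of [Sigma t] is a face of [Ds t.+1] and of all later complexes, so it cannot be a
    non-face again. *)
Lemma Sigma_disjoint t r s : (t < w)%N -> (r < w)%N ->
  s \in Sigma t -> s \in Sigma r -> t = r.
Proof.
suff H t' r' : (t' < r' < w)%N -> s \in Sigma t' -> s \notin Sigma r'.
  move=> lttw ltrw st sr; case: (ltngtP t r) => // lt.
    by have := H t r; rewrite lt ltrw sr => /(_ isT st).
  by have := H r t; rewrite lt lttw st => /(_ isT sr).
move=> /andP[lt_tr ltrw] st; apply: contraL (st) => sr; apply/negP => _.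
have := Sigma_nonface (t := t'.+1) (r := r') _ sr; rewrite lt_tr ltrw => /(_ isT).
rewrite Ds_succ ?(ltn_trans lt_tr) // => /negP; apply.
by move: st; rewrite !inE => /andP[].
Qed.

Lemma Sigma_triangle t p q s : (t < w)%N -> q != s -> p != q -> p != s ->
  [set p; q] \in Sigma t -> [set p; s] \in Sigma t ->
  exists2 r, (t < r < w)%N & [set q; s] \in Sigma r.
Proof.
move=> lttw ne_qs ne_pq ne_ps pqS psS.
have := edge_nonface_triangle (Ds_pure (ltnW lttw)) (Ds_treeP lttw) ne_qs ne_pq ne_ps pqS psS.
rewrite -Ds_succ // => /(Ds_nonface lttw)[r [u [/andP[ltr lrw] uS uqs]]].
have [a [b [ne_ab uE]]] := Sigma_pair lrw uS; exists r; first by rewrite ltr.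
suff <- : u = [set q; s] by [].
by apply/eqP; rewrite eqEcard uqs uE !cards2 ne_ab ne_qs.
Qed.

Definition standard m : Prop :=
  forall r, (r < w)%N -> [set i | (w - r <= m i)%N] \in Ds r.

(** If the level set for [r] is not a face, it contains a pair of some [Sigma t] with [t >= r]. The
    threshold of [t] is at most that of [r], so this pair violates the condition at [t] as well. *)
Lemma nonstandardP m : ~ standard m <-> exists r p q,
  [/\ (r < w)%N, p != q, [set p; q] \in Sigma r, (w - r <= m p)%N & (w - r <= m q)%N].
Proof.
split=> [nstd|[r [p [q [ltrw ne_pq pqS mp mq]]]] std]; last first.
  have := Sigma_nonface (t := r) (r := r) _ pqS; rewrite leqnn ltrw => /(_ isT)/negP; apply.
  have [cxr _] := Ds_pure (ltnW ltrw).
  by apply: face_sub (std r ltrw) => //; rewrite subUset !sub1set !inE mp mq.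
have /existsP[r rN] : [exists r : 'I_w, [set i | (w - r <= m i)%N] \notin Ds r].
  apply/negbNE; apply/negP => /existsPn all; apply: nstd => r ltrw.
  by have := all (Ordinal ltrw); rewrite negbK.
have [t [s [/andP[lert lttw] sS sL]]] := Ds_nonface (ltnW (ltn_ord r)) rN.
have [p [q [ne_pq sE]]] := Sigma_pair lttw sS; exists t, p, q.
rewrite sE in sS sL.
have /andP[mp mq] : (w - r <= m p)%N && (w - r <= m q)%N.
  by move: sL; rewrite subUset !sub1set !inE.
by split=> //; [apply: leq_trans _ mp|apply: leq_trans _ mq]; rewrite leq_sub2l.
Qed.

Section Filtration.
Variables (k : fieldType) (ys : seq {mpoly k[n]}).
Hypothesis regular_facets : forall F, F \in facets D ->
  weakly_regular (coideal (fun m => forall i, i \notin F -> m i = 0%N)) ys.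

(* The monomials x^m in the variables of G such that x^m x^b satisfies the
   conditions of [standard] for r < s, restricted to G. *)
Definition local_standard s G b m : Prop :=
  (forall i, i \notin G -> m i = 0%N) /\
  forall r, (r < s)%N -> [set i in G | (w - r <= m i + b i)%N] \in Ds r.

Lemma local_standard_downward s G b : (s <= w)%N ->
  downward_closed (local_standard s G b).
Proof.
move=> lesw m m' /mnm_lepP lemm' [m'0 std]; split=> [i /m'0 m'i|r ltrs].
  by apply/eqP; rewrite -leqn0 -m'i.
have [cxr _] := Ds_pure (ltnW (leq_trans ltrs lesw)).
apply: face_sub (std r ltrs) => //; apply/subsetP => i; rewrite !inE => /andP[-> /=].
by move/leq_trans; apply; rewrite leq_add2r.
Qed.

(* For G = F :|: F' with F = G :\ q and F' = G :\ p, cut the standard monomials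
   according to whether q reaches the threshold w - s: if it does not, q is
   unconstrained below and the rest lives on F; if it does, then p cannot reach
   the threshold since {p, q} is not a face of Ds s, and the rest lives on F'. *)
Lemma weakly_regular_local_standard s G b : (s <= w)%N -> G \in facets (Ds s) ->
  (forall i, i \in G -> (b i <= w - s)%N) ->
  weakly_regular (coideal (local_standard s G b)) ys.
Proof.
elim: s G b => [|s IHs] G b lesw GD leb.
  have [D0 _] := itD; rewrite D0 in GD.
  apply: weakly_regular_coideal_ext (regular_facets GD) => m.
  by split=> [m0|[]//]; split.
have lesw' := ltnW lesw; have treeT := Ds_treeP lesw; have pureT := Ds_pure lesw'.
have [cxs _] := pureT.
rewrite Ds_succ // in GD; have [F [F' [TFF' GE]]] := edge_union_facet GD.
have [p [q [pF pF' qF' qF [ne_pq FE F'E pqN]]]] := edge_pair_nonface pureT treeT TFF'.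
rewrite -GE in FE F'E; have [FD F'D _ _] := edge_facets pureT treeT TFF'.
have [pG qG] : p \in G /\ q \in G by rewrite GE !inE pF qF' orbT.
set e := (w - s)%N; have eE : e = (w - s.+1).+1 by rewrite /e -subSn // subSS.
(* The bound on [b] is the threshold of level [s.+1], one below [e]. This leaves room for lifting
   [q] to [e], the largest base value allowed at level [s]. *)
have ltbe i : i \in G -> (b i < e)%N by rewrite eE ltnS; apply: leb.
have lerw r : (r < s.+1)%N -> (e <= w - r)%N by rewrite ltnS => lers; rewrite leq_sub2l.
have inF i : (i \in F) = (i != q) && (i \in G) by rewrite {1}FE !inE.
have inF' i : (i \in F') = (i != p) && (i \in G) by rewrite {1}F'E !inE.
(* Multiplication by x^v lifts [q], counted from the base [b], exactly to the threshold [e]. *)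
pose v := (U_(q) *+ (e - b q))%MM.
have vE i : v i = if i == q then (e - b q)%N else 0%N.
  by rewrite mulmnE mnm1E eq_sym; case: eqP; rewrite ?mul1n.
have bvE i : (b + v)%MM i = if i == q then e else b i.
  by rewrite mnmDE vE; case: eqP => [->|_]; rewrite ?addn0 // subnKC // ltnW ?ltbe.
apply: (@weakly_regular_split _ _ _ v); first exact: local_standard_downward.
  have regF : weakly_regular (coideal (local_standard s F b)) ys.
    by apply: IHs => // i; rewrite inF => /andP[_ /ltbe/ltnW].
  have := @weakly_regular_thicken _ _ _ q (e - b q) _ _ _ regF.
  move=> H; apply: weakly_regular_coideal_ext (H _ _); first last.
  - by move=> m [m0 _]; apply: m0.
  - exact: local_standard_downward.
  move=> m; rewrite mul_mnm1_le -ltnNge; set m' := mnm_drop q m.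
  have m'E i : i != q -> m' i = m i by rewrite mnm_dropE => /negPf->.
  (* All thresholds [w - r] with [r <= s] are at least [e], so below [e] the vertex [q] is in no
     level set. *)
  have lvl r : (r < s.+1)%N -> (m q < e - b q)%N ->
    [set i in G | (w - r <= m i + b i)%N] = [set i in F | (w - r <= m' i + b i)%N].
    move=> ltrs ltm; apply/setP => i; rewrite !inE inF; case: (eqVneq i q) => [->|/m'E->//].
    by rewrite qG /=; apply/negbTE; rewrite -ltnNge addnC; apply: leq_trans (lerw r ltrs); rewrite -ltn_subRL.
  split=> [[ltm [m0 std]]|[[m0 std] ltm]]; split=> //; split.
  - by move=> i iG; rewrite -m'E ?m0 //; [rewrite inF (negPf iG) andbF|apply: contraNneq iG => ->].
  (* At [r = s] the level set lies in the face [F], so that condition is automatic; the others are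
     those of [local_standard s]. *)
  - move=> r ltrs; rewrite lvl //; move: ltrs; rewrite ltnS leq_eqVlt => /predU1P[->|/std//].
    by apply: (face_sub cxs _ (facet_mem FD)); apply/subsetP => i; rewrite inE => /andP[].
  - by move=> i; rewrite inF negb_and negbK mnm_dropE; case: eqP => //= _ /m0.
  - by move=> r ltrs; rewrite -lvl //; [apply: std; apply: ltnW|apply: ltnW].
have regF' : weakly_regular (coideal (local_standard s F' (b + v)%MM)) ys.
  apply: IHs => // i; rewrite inF' bvE => /andP[_ iG].
  by case: eqP => // _; apply/ltnW/ltbe.
have := @weakly_regular_thicken _ _ _ p (e - b p) _ _ _ regF'.
move=> H; apply: weakly_regular_coideal_ext (H _ _); first last.
- by move=> m [m0 _]; apply: m0.
- exact: local_standard_downward.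
move=> m; set m' := mnm_drop p m.
have m'E i : i != p -> m' i = m i by rewrite mnm_dropE => /negPf->.
have mvE i : ((m + v)%MM i + b i = m i + (b + v)%MM i)%N by rewrite !mnmDE -addnA (addnC (v i)).
have bvp : (b + v)%MM p = b p by rewrite bvE (negPf ne_pq).
have lvl r : (r < s.+1)%N -> (m p < e - b p)%N ->
    [set i in G | (w - r <= (m + v)%MM i + b i)%N] =
    [set i in F' | (w - r <= m' i + (b + v)%MM i)%N].
  move=> ltrs ltm; apply/setP => i; rewrite !inE inF' mvE; case: (eqVneq i p) => [->|/m'E->//].
  by rewrite pG bvp /=; apply/negbTE; rewrite -ltnNge addnC; apply: leq_trans (lerw r ltrs); rewrite -ltn_subRL.
split=> [[ltm [m0 std]]|[m0 std]].
  split=> // [i iG|r ltrs].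
    rewrite mnmDE vE -m'E ?m0; last 2 first.
    - by rewrite inF' (negPf iG) andbF.
    - by apply: contraNneq iG => ->.
    by case: eqP iG => // ->; rewrite qG.
  rewrite lvl //; move: ltrs; rewrite ltnS leq_eqVlt => /predU1P[->|/std//].
  by apply: (face_sub cxs _ (facet_mem F'D)); apply/subsetP => i; rewrite inE => /andP[].
have ltm : (m p < e - b p)%N.
  rewrite ltnNge; apply: contra pqN => leem.
  apply: face_sub (std s (ltnSn s)) => //; rewrite subUset !sub1set !inE pG qG /= -/e.
  rewrite !mvE bvp bvE eqxx leq_addl andbT.
  by move: leem; rewrite leq_subLR addnC.
split=> //; split=> [i|r ltrs].
  rewrite inF' negb_and negbK mnm_dropE; case: eqP => //= _ /m0/eqP.
  by rewrite mnmDE addn_eq0 => /andP[/eqP].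
by rewrite -lvl //; [apply: std; apply: ltnW|apply: ltnW].
Qed.

Lemma weakly_regular_standard : weakly_regular (coideal standard) ys.
Proof.
have fullD : [set: 'I_n] \in facets (Ds w).
  apply: (facet_of_size (Ds_pure (leqnn _))); first exact: Ds_full.
  by rewrite cardsT card_ord subnKC ?facet_size_le.
have H := @weakly_regular_local_standard w setT 0%MM (leqnn _) fullD.
apply: weakly_regular_coideal_ext (H _) => [m|i _]; last by rewrite mnm0E.
have lvlE r : [set i in setT | (w - r <= m i + (0%MM : 'X_{1..n}) i)%N] =
    [set i | (w - r <= m i)%N].
  by apply/setP => i; rewrite !inE mnm0E addn0.
split=> [[_ std] r|std]; first by rewrite -lvlE; apply: std.
by split=> [i|r]; [rewrite inE | rewrite lvlE; apply: std].
Qed.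

End Filtration.

End IteratedCliqueTree.

(** * Deformation and genericity *)

Section MonomialIdealFacts.
Variables (k : fieldType) (n : nat).
Local Notation S := {mpoly k[n]}.
Implicit Types (B : 'X_{1..n} -> Prop) (m : 'X_{1..n}) (s : {set 'I_n}) (f : S).

Lemma mem_monomials_ideal B m : B m -> monomials_ideal B ('X_[m] : S).
Proof. by move=> Bm; rewrite /monomials_ideal; apply: mem_ideal_gen; exists m. Qed.

Lemma monomials_idealP B f : monomials_ideal B f <->
  forall m, m \in msupp f -> exists2 b, B b & (b <= m)%MM.
Proof.
split=> [|Hf].
  apply: (@ideal_gen_min _ _ (fun g => forall m, m \in msupp g -> exists2 b, B b & (b <= m)%MM)).
    split.
  - by move=> m; rewrite msupp0.
  - by move=> p q Hp Hq m /msuppD_le; rewrite mem_cat => /orP[/Hp|/Hq].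
  - move=> a p Hp m /msuppM_le/allpairsP[[m1 m2]] /= [_ /Hp[b Bb bm2] ->].
    by exists b => //; apply: lepm_trans bm2 _; apply: lem_addl.
  - by move=> _ [b Bb ->] m; rewrite msuppX inE => /eqP->; exists b => //; apply: lepm_refl.
have idB : is_ideal (monomials_ideal B : S -> Prop) := ideal_genP _.
rewrite [f]mpolyE big_seq; apply: ideal_big => // m /Hf[b Bb bm].
have [_ _ IM] := idB; rewrite -(submK bm) mpolyXD scalerAl; apply: IM.
exact: mem_monomials_ideal.
Qed.

Lemma monomials_idealX B m :
  monomials_ideal B ('X_[m] : S) <-> exists2 b, B b & (b <= m)%MM.
Proof.
rewrite monomials_idealP; split=> [|Hm m']; first by apply; rewrite msuppX inE.
by rewrite msuppX inE => /eqP->.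
Qed.

Lemma monomials_ideal_ext B B' f : (forall m, B m <-> B' m) ->
  monomials_ideal B f <-> monomials_ideal B' f.
Proof.
by move=> BB'; rewrite !monomials_idealP; split=> Hf m /Hf[b /BB' Bb bm]; exists b.
Qed.

Definition mnm_set s : 'X_{1..n} := [multinom (i \in s : nat) | i < n].

Lemma mnm_setE s i : mnm_set s i = (i \in s).
Proof. exact: mnmE. Qed.

Lemma mpolyX_set s : 'X_[mnm_set s] = \prod_(i in s) 'X_i :> S.
Proof.
rewrite mpolyXE_id [RHS]big_mkcond; apply: eq_bigr => i _.
by rewrite mnm_setE; case: ifP.
Qed.

Lemma mnm_set_mul_le s s' e e' : (0 < e)%N ->
  (mnm_set s *+ e <= mnm_set s' *+ e')%MM -> s \subset s'.
Proof.
move=> e_gt0 /mnm_lepP le; apply/subsetP => i si; have := le i.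
by rewrite !mulmnE !mnm_setE si mul1n; case: (i \in s') => //; rewrite mul0n leqNgt e_gt0.
Qed.

Lemma mnm_set_pair (p q : 'I_n) : p != q -> mnm_set [set p; q] = (U_(p) + U_(q))%MM.
Proof.
move=> ne_pq; apply/mnmP => i; rewrite mnm_setE mnmDE !mnm1E !inE !(eq_sym i).
case: eqVneq => [pi|] //=; case: eqVneq => [qi|] //.
by rewrite pi qi eqxx in ne_pq.
Qed.

Lemma stanley_reisnerE (D : {set {set 'I_n}}) f : stanley_reisner k D f <->
  monomials_ideal (fun m => exists2 s, s \notin D & m = mnm_set s) f.
Proof.
split; apply: ideal_gen_min; try exact: ideal_genP.
  move=> _ [s sD ->]; apply: mem_ideal_gen; exists (mnm_set s); last by rewrite mpolyX_set.
  by exists s.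
move=> _ [_ [s sD ->] ->]; apply: mem_ideal_gen.
by exists s; rewrite ?mpolyX_set.
Qed.

Lemma min_gen_stanley_reisner (D : {set {set 'I_n}}) m :
  min_gen (stanley_reisner k D) m <-> exists2 s, s \in min_nonfaces D & m = mnm_set s.
Proof.
split=> [[]|[s]]; rewrite ?stanley_reisnerE ?monomials_idealX.
  move=> [_ [s sD ->] sm] minm; have [u umin us] := minset_exists (P := fun u => u \notin D) sD.
  have uD : u \notin D by case/minsetP: (umin).
  exists u; first by rewrite inE.
  apply/esym/minm.
    apply/stanley_reisnerE/monomials_idealX; exists (mnm_set u); last exact: lepm_refl.
    by exists u.
  apply: lepm_trans sm; apply/mnm_lepP => i; rewrite !mnm_setE.
  by case: (boolP (i \in u)) => // /(subsetP us)->.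
rewrite inE => /minsetP[sD mins] ->; split.
  rewrite stanley_reisnerE monomials_idealX; exists (mnm_set s); last exact: lepm_refl.
  by exists s.
move=> m'; rewrite stanley_reisnerE monomials_idealX => -[_ [u uD ->] um'] m's.
have us : u = s.
  apply: mins => //; apply: (@mnm_set_mul_le u s 1 1) => //; rewrite !mulm1n.
  exact: lepm_trans um' m's.
rewrite us in um'; apply/mnmP => i; apply/eqP; rewrite eqn_leq.
by rewrite (mnm_lepP m's) (mnm_lepP um').
Qed.

Lemma ideal_sum_ideal r (I : 'I_r -> S -> Prop) :
  (forall t, is_ideal (I t)) -> is_ideal (ideal_sum I).
Proof.
move=> idI; split.
- exists (fun _ => 0); last by rewrite big1.
  by move=> t; case: (idI t).
- move=> _ _ [y Iy ->] [z Iz ->]; exists (fun t => y t + z t); last by rewrite big_split.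
  by move=> t; case: (idI t) => _ D _; apply: D.
- move=> a _ [y Iy ->]; exists (fun t => a * y t); last by rewrite mulr_sumr.
  by move=> t; case: (idI t) => _ _ M; apply: M.
Qed.

Lemma mem_ideal_sum r (I : 'I_r -> S -> Prop) t f :
  (forall t, is_ideal (I t)) -> I t f -> ideal_sum I f.
Proof.
move=> idI Itf; exists (fun u => if u == t then f else 0).
  by move=> u; case: eqP => [->//|_]; case: (idI u).
by rewrite -big_mkcond big_pred1_eq.
Qed.

End MonomialIdealFacts.

Section CliqueTreeIdeal.
Variables (k : fieldType) (n d : nat) (D : {set {set 'I_n}}).
Variables (Ds : nat -> {set {set 'I_n}}) (Ts : nat -> rel {set 'I_n}).
Hypotheses (pureD : pure_of_size D d) (itD : iterated_clique_tree D d Ds Ts).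
Local Notation S := {mpoly k[n]}.
Local Notation w := (n - d)%N.
Local Notation Sigma t := (edge_nonfaces (Ds t) (Ts t)).
Local Notation M := (clique_tree_ideal k d Ds Ts).
Implicit Types (t r : nat) (s : {set 'I_n}) (p q i : 'I_n) (m b : 'X_{1..n}) (f : S).

Definition clique_tree_gen m : Prop :=
  exists t s, [/\ (t < w)%N, s \in Sigma t & m = (mnm_set s *+ (w - t))%MM].

Lemma clique_tree_gen_cover m :
  (exists2 b, clique_tree_gen b & (b <= m)%MM) <-> ~ standard d Ds m.
Proof.
rewrite (nonstandardP pureD itD); split.
  case=> _ [t [s [lttw sS ->]]] /mnm_lepP le.
  have [p [q [ne_pq sE]]] := Sigma_pair pureD itD lttw sS; exists t, p, q.
  rewrite -sE; split=> //.
    by have := le p; rewrite mulmnE mnm_setE sE set21 mul1n.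
  by have := le q; rewrite mulmnE mnm_setE sE set22 mul1n.
case=> t [p [q [lttw ne_pq pqS mp mq]]].
exists (mnm_set [set p; q] *+ (w - t))%MM; first by exists t, [set p; q].
apply/mnm_lepP => i; rewrite mulmnE mnm_setE in_set2.
by case: eqP => [->|_]; case: eqP => [->|_]; rewrite ?mul1n.
Qed.

Lemma clique_tree_idealE f : M f <-> monomials_ideal clique_tree_gen f.
Proof.
have idP t : is_ideal (pair_power_ideal (n - d - t) (Sigma t) : S -> Prop) by apply: ideal_genP.
have XE p q e : p != q -> 'X_p ^+ e * 'X_q ^+ e = 'X_[mnm_set [set p; q] *+ e] :> S.
  by move=> ne_pq; rewrite -exprMn -mpolyXD mpolyXn mnm_set_pair.
split.
  case=> y Iy ->; apply: ideal_big => [|t _]; first exact: ideal_genP.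
  apply: ideal_gen_min (Iy t); first exact: ideal_genP.
  move=> _ [p [q [ne_pq pqS ->]]]; rewrite XE //; apply: mem_ideal_gen.
  exists (mnm_set [set p; q] *+ (w - t))%MM => //.
  by exists t, [set p; q].
rewrite /clique_tree_ideal; apply: ideal_gen_min.
  by apply: ideal_sum_ideal => t; apply: idP.
move=> _ [_ [t [s [lttw sS ->]]] ->].
have [p [q [ne_pq sE]]] := Sigma_pair pureD itD lttw sS.
apply: (@mem_ideal_sum _ _ _ _ (Ordinal lttw)); first by move=> u; apply: idP.
by apply: mem_ideal_gen; exists p, q; rewrite XE // -sE.
Qed.

Lemma clique_tree_ideal_coideal f : M f <-> coideal (standard d Ds) f.
Proof.
rewrite clique_tree_idealE monomials_idealP; split=> [Mf m std|If m mf].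
  apply/eqP; rewrite mcoeff_eq0; apply/negP => /Mf; rewrite clique_tree_gen_cover.
  exact.
by apply/clique_tree_gen_cover => std; rewrite mcoeff_msupp If ?eqxx in mf.
Qed.

(** By [Ds_nonface] at level 0 a minimal non-face contains a pair of some [Sigma t], which is itself
    a non-face of [D]; minimality makes them equal. *)
Lemma min_nonface_Sigma s :
  s \in min_nonfaces D <-> exists2 t, (t < w)%N & s \in Sigma t.
Proof.
have [D0 _] := itD; split=> [|[t lttw sS]].
  rewrite inE => /minsetP[sD mins]; rewrite -D0 in sD.
  have [t [u [/andP[_ lttw] uS us]]] := Ds_nonface pureD itD (leq0n _) sD.
  exists t => //; suff <- : u = s by [].
  apply: mins => //; rewrite -D0; apply: (Sigma_nonface pureD itD) uS.
  by rewrite leq0n.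
have [p [q [ne_pq sE]]] := Sigma_pair pureD itD lttw sS; rewrite sE.
apply: pair_min_nonface pureD _ _ ne_pq _.
rewrite -sE -D0; apply: (Sigma_nonface pureD itD) sS.
by rewrite leq0n.
Qed.

(** The support of a minimal generator lies in exactly one [Sigma t], by [min_nonface_Sigma] and
    [Sigma_disjoint], so the choice is forced. Other monomials are left as they are, which keeps
    their support. *)
Definition clique_tree_star m : 'X_{1..n} :=
  if [pick t : 'I_w | [set i | (0 < m i)%N] \in Sigma t] is Some t
  then (m *+ (w - t))%MM else m.

Lemma clique_tree_starE t s : (t < w)%N -> s \in Sigma t ->
  clique_tree_star (mnm_set s) = (mnm_set s *+ (w - t))%MM.
Proof.
move=> lttw sS; rewrite /clique_tree_star.
have -> : [set i | (0 < mnm_set s i)%N] = s.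
  by apply/setP => i; rewrite inE mnm_setE; case: (_ \in _).
case: pickP => [u uS|/(_ (Ordinal lttw))]; last by rewrite /= sS.
by rewrite (Sigma_disjoint pureD itD (ltn_ord u) lttw uS sS).
Qed.

Lemma clique_tree_deformation : deformation M (stanley_reisner k D).
Proof.
split.
  exists (fun m => exists2 s, s \notin D & m = mnm_set s); last exact: stanley_reisnerE.
  by move=> _ [s _ ->] i; rewrite mnm_setE; case: (_ \in _).
exists clique_tree_star => [m _ i|f].
  rewrite /clique_tree_star; case: pickP => // t _.
  by rewrite mulmnE muln_gt0 subn_gt0 ltn_ord andbT.
rewrite clique_tree_idealE; apply: monomials_ideal_ext => m; split.
  case=> t [s [lttw sS ->]]; exists (mnm_set s); last by rewrite (clique_tree_starE lttw).
  by apply/min_gen_stanley_reisner; exists s => //; apply/min_nonface_Sigma; exists t.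
case=> _ /min_gen_stanley_reisner[s /min_nonface_Sigma[t lttw sS] ->] ->.
by exists t, s; rewrite (clique_tree_starE lttw).
Qed.

(** No generator properly divides another: divisibility gives an inclusion of pairs, hence the same
    pair, hence the same level and exponent. *)
Lemma clique_tree_min_gen m : min_gen M m <-> clique_tree_gen m.
Proof.
split=> [[]|genm].
  rewrite clique_tree_idealE monomials_idealX => -[b genb bm] minm.
  suff <- : b = m by [].
  apply: minm => //; rewrite clique_tree_idealE monomials_idealX.
  by exists b => //; apply: lepm_refl.
split=> [|m']; rewrite clique_tree_idealE monomials_idealX.
  by exists m => //; apply: lepm_refl.
case=> b genb bm' m'm; suff bE : b = m.
  by apply/mnmP => i; apply/eqP; rewrite eqn_leq (mnm_lepP m'm) -{1}bE (mnm_lepP bm').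
have bm := lepm_trans bm' m'm; case: genb genm bm => t [s [lttw sS ->]] [r [u [ltrw uS ->]]].
move/mnm_set_mul_le; rewrite subn_gt0 => /(_ lttw) su.
have [p [q [ne_pq sE]]] := Sigma_pair pureD itD lttw sS.
have [a [c [ne_ac uE]]] := Sigma_pair pureD itD ltrw uS.
have {}su : s = u by apply/eqP; rewrite eqEcard su sE uE !cards2 ne_pq ne_ac.
by rewrite -su in uS *; rewrite (Sigma_disjoint pureD itD lttw ltrw sS uS).
Qed.

Lemma Sigma_pair_at t s i : (t < w)%N -> s \in Sigma t -> i \in s ->
  exists2 q, i != q & s = [set i; q].
Proof.
move=> lttw /(Sigma_pair pureD itD lttw)[p [q [ne_pq ->]]].
rewrite in_set2 => /pred2P[->|->]; first by exists q.
by exists p; rewrite 1?eq_sym // setUC.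
Qed.

(** A common positive degree in x_i forces both generators to come from the same [Sigma t]. Their
    other vertices [q] and [s] form a pair of some [Sigma r] with [r > t], whose exponent [w - r] is
    strictly smaller. *)
Lemma clique_tree_generic : generic_ideal M.
Proof.
split; first by exists clique_tree_gen; apply: clique_tree_idealE.
move=> m1 m2 /clique_tree_min_gen[t [s1 [lttw s1S ->]]].
move=> /clique_tree_min_gen[t' [s2 [lttw' s2S ->]]] ne_m [i].
rewrite !mulmnE !mnm_setE; case: (boolP (i \in s1)) => // is1 _.
case: (boolP (i \in s2)) => [is2|_]; last by rewrite mul1n mul0n; lia.
rewrite !mul1n => tt'; have {tt'} tt' : t' = t by lia.
rewrite {lttw'}tt' in s2S ne_m *.
have [q ne_iq s1E] := Sigma_pair_at lttw s1S is1.
have [s ne_is s2E] := Sigma_pair_at lttw s2S is2.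
have ne_qs : q != s by apply: contra_not_neq ne_m => qs; rewrite s1E s2E qs.
rewrite s1E in s1S; rewrite s2E in s2S.
have [r /andP[ltr ltrw] qsS] := Sigma_triangle pureD itD lttw ne_qs ne_iq ne_is s1S s2S.
(* The third generator differs from the other two because it does not involve x_i. *)
have neq_at (u : {set 'I_n}) : i \in u ->
    (mnm_set [set q; s] *+ (w - r))%MM <> (mnm_set u *+ (w - t))%MM.
  move=> iu /mnmP/(_ i); rewrite !mulmnE !mnm_setE iu in_set2.
  by rewrite (negPf ne_iq) (negPf ne_is) /=; lia.
exists (mnm_set [set q; s] *+ (w - r))%MM; split; try exact: neq_at.
  by apply/clique_tree_min_gen; exists r, [set q; s].
have lcmE (m m' : 'X_{1..n}) j : mlcm m m' j = maxn (m j) (m' j) by rewrite mnmE.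
move=> j; rewrite lcmE !mulmnE !mnm_setE s1E s2E !in_set2.
case: (eqVneq j q) => [->|_] /=.
  by rewrite orbT !mul1n leq_max => _; apply/orP; left; lia.
case: (eqVneq j s) => [->|_] //=.
by rewrite orbT !mul1n leq_max => _; apply/orP; right; lia.
Qed.

Lemma weakly_regular_clique_tree : tree_complex D ->
  exists theta : 'I_d -> S, forall g : 'I_d -> {poly k}, (forall c, g c \is monic) ->
    weakly_regular M [seq poly_at (@mpolyC n k) (g c) (theta c) | c <- enum 'I_d].
Proof.
move=> treeD; have [col col_inj] := balanced_coloring treeD pureD.
exists (fun c => \sum_(i | col i == c) 'X_i) => g mong.
apply: (weakly_regular_ext (I := coideal (standard d Ds))).
  by move=> f; symmetry; apply: clique_tree_ideal_coideal.
apply: (weakly_regular_standard pureD itD) => F FD; have [_ /(_ F FD) sF] := pureD.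
have dF : downward_closed (fun m => forall i, i \notin F -> m i = 0%N).
  by move=> m m' /mnm_lepP lemm' Nm' i /Nm' m'i0; apply/eqP; rewrite -leqn0 -m'i0.
(* [F] has [d] vertices of distinct colours, so each of the [d] colours occurs on it exactly
   once. *)
have /fin_all_exists[v vP] c : exists x, x \in F /\ col x = c.
  suff : c \in col @: F by case/imsetP => x xF ->; exists x.
  suff -> : col @: F = setT by rewrite inE.
  apply/eqP; rewrite eqEcard subsetT cardsT card_ord card_in_imset ?sF ?leqnn //.
  exact: (col_inj F FD).
apply: (@weakly_regular_face _ _ _ _ _ v) => //.
- rewrite map_inj_uniq ?enum_uniq // => c c' E.
  by have [[_ <-] [_ <-]] := (vP c, vP c'); rewrite E.
- by move=> c _; case: (vP c).
move=> c _; have [vF colv] := vP c.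
rewrite (bigD1 (v c)) ?colv //= addrAC subrr add0r.
apply: ideal_big => [|i /andP[/eqP coli ne_iv]]; first exact: coideal_is_ideal.
rewrite -['X_i]mul1r; apply: coidealX => // /(_ i).
have iF : i \notin F.
  by apply: contra ne_iv => iF; apply/eqP; apply: (col_inj F FD) => //; rewrite coli.
by move/(_ iF); rewrite mnm1E eqxx.
Qed.

End CliqueTreeIdeal.

(** * Finite generation *)

Section Noetherian.

(** Quantifies over [Prop]-valued ideals and includes the unit ideal, as the ideals of leading
    coefficients in Hilbert's argument require. *)
Definition fg_ideals (R : comNzRingType) : Prop :=
  forall I : R -> Prop, is_ideal I -> exists s, forall x, I x <-> seq_ideal s x.

Lemma fg_ideals_noetherian (R : comNzRingType) : fg_ideals R -> noetherian R.
Proof.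
move=> fgR P [P0 _ PD]; apply: (fgR (fun x => x \in P)); split=> // [x y Px Py|a x Px].
  by rewrite -[x]mul1r; apply: PD.
by rewrite -[a * x]addr0; apply: PD.
Qed.

Lemma fg_ideals_surj (R Q : comNzRingType) (f : {rmorphism R -> Q}) :
  (forall q, exists x, f x = q) -> fg_ideals R -> fg_ideals Q.
Proof.
move=> fsurj fgR I idI; have [I0 ID IM] := idI.
have [|s sP] := fgR (fun x => I (f x)).
  by split=> [|x y Ix Iy|a x Ix]; rewrite ?rmorph0 ?rmorphD ?rmorphM //; auto.
exists (map f s) => q; split.
  have [x <-] := fsurj q; move/sP; apply: (@ideal_gen_min _ _ (fun x => seq_ideal (map f s) (f x))).
    have [J0 JD JM] : is_ideal (seq_ideal (map f s)) := ideal_genP _.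
    by split=> [|y z Iy Iz|a y Iy]; rewrite ?rmorph0 ?rmorphD ?rmorphM //; auto.
  by move=> z zs; apply: mem_ideal_gen; apply: map_f.
apply: ideal_gen_min => // _ /mapP[z zs ->]; apply/sP; exact: mem_ideal_gen.
Qed.

Lemma fg_ideals_field (k : fieldType) : fg_ideals k.
Proof.
move=> I [I0 ID IM]; have idV (s : seq k) : is_ideal (seq_ideal s) by apply: ideal_genP.
case: (boolp.EM (exists2 a, I a & a != 0)) => [[a Ia a0]|none].
  exists [:: a] => x; split=> [_|].
    have [_ _ VM] := idV [:: a]; rewrite -[x](divfK a0); apply: VM.
    exact/mem_ideal_gen/mem_head.
  by apply: ideal_gen_min => // z; rewrite inE => /eqP->.
exists [::] => x; rewrite seq_ideal_nil; split=> [Ix|->//].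
by apply/eqP; apply: contra_notT none => x0; exists x.
Qed.

(** * Hilbert's basis theorem *)

Section HilbertBasis.
Variables (R : comNzRingType) (I : {poly R} -> Prop).
Hypothesis (idI : is_ideal I).
Implicit Types (f g : {poly R}) (a : R).

(** The leading coefficients in degree [m], together with 0: bounding the size rather than fixing it
    gives closure under addition. *)
Definition coef_ideal m a : Prop := exists f, [/\ I f, (size f <= m.+1)%N & f`_m = a].

Lemma coef_ideal_ideal (J : {poly R} -> Prop) m : is_ideal J ->
  is_ideal (fun a => exists f, [/\ J f, (size f <= m.+1)%N & f`_m = a]).
Proof.
case=> J0 JD JM; split.
- by exists 0; rewrite size_poly0 coef0.
- move=> _ _ [f [Jf sf <-]] [g [Jg sg <-]]; exists (f + g); rewrite coefD; split; auto.
  by apply: leq_trans (size_polyD _ _) _; rewrite geq_max sf.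
- move=> a _ [f [Jf sf <-]]; exists (a%:P * f); rewrite coefCM; split; auto.
  by rewrite mul_polyC; apply: leq_trans (size_scale_leq _ _) sf.
Qed.

Lemma coef_ideal_le m m' a : (m <= m')%N -> coef_ideal m a -> coef_ideal m' a.
Proof.
move=> lemm' [f [If sf fm]]; exists (f * 'X^(m' - m)); split.
- exact: ideal_mulr.
- apply/leq_sizeP => j ltj; rewrite coefMXn; case: ltnP => // lej.
  by apply: (leq_sizeP _ _ sf); lia.
- by rewrite coefMXn ltnNge leq_subr /= subKn.
Qed.

(** The union of the increasing chain is an ideal with finitely many generators, all of which occur
    by some stage. *)
Lemma coef_ideal_stable : fg_ideals R ->
  exists N, forall m a, coef_ideal m a -> coef_ideal N a.
Proof.
move=> fgR; have [|s sP] := fgR (fun a => exists m, coef_ideal m a).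
  have idC m := coef_ideal_ideal m idI; split.
  - by exists 0%N; case: (idC 0%N).
  - move=> a b [m Ca] [m' Cb]; exists (maxn m m'); case: (idC (maxn m m')) => _ D _.
    by apply: D; [apply: coef_ideal_le Ca|apply: coef_ideal_le Cb]; rewrite ?leq_maxl ?leq_maxr.
  - by move=> a b [m Cb]; exists m; case: (idC m) => _ _ M; apply: M.
have [N sN] : exists N, forall a, a \in s -> coef_ideal N a.
  have : forall a, a \in s -> exists m, coef_ideal m a.
    by move=> a sa; apply/sP/mem_ideal_gen.
  elim: s {sP} => [|a s IHs] Hs; first by exists 0%N.
  have [|N sN] := IHs; first by move=> b bs; apply: Hs; rewrite inE bs orbT.
  have [m Ca] := Hs a (mem_head _ _); exists (maxn m N) => b; rewrite inE => /predU1P[->|/sN].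
    by apply: coef_ideal_le Ca; apply: leq_maxl.
  by apply: coef_ideal_le; apply: leq_maxr.
exists N => m a Ca; have : seq_ideal s a by apply/sP; exists m.
by apply: ideal_gen_min; first exact: coef_ideal_ideal.
Qed.

Lemma coef_ideal_lift m : fg_ideals R -> exists G : seq {poly R},
  (forall f, f \in G -> I f) /\
  forall a, coef_ideal m a ->
    exists g, [/\ seq_ideal G g, (size g <= m.+1)%N & g`_m = a].
Proof.
move=> fgR; have [s sP] := fgR _ (coef_ideal_ideal m idI).
have [G [GI Gs]] : exists G : seq {poly R}, (forall f, f \in G -> I f) /\
    forall a, a \in s -> exists2 f, f \in G & (size f <= m.+1)%N /\ f`_m = a.
  have : forall a, a \in s -> coef_ideal m a by move=> a sa; apply/sP/mem_ideal_gen.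
  elim: s {sP} => [|a s IHs] Hs; first by exists [::].
  have [|G [GI Gs]] := IHs; first by move=> b bs; apply: Hs; rewrite inE bs orbT.
  have [f [If sf fa]] := Hs a (mem_head _ _); exists (f :: G); split.
    by move=> g; rewrite inE => /predU1P[->|/GI].
  move=> b; rewrite inE => /predU1P[->|/Gs[g gG Hg]]; first by exists f; rewrite ?mem_head.
  by exists g; rewrite // inE gG orbT.
exists G; split=> // a /sP; apply: (ideal_gen_min (coef_ideal_ideal m (ideal_genP _))) => z.
by case/Gs => f fG [sf fz]; exists f; split=> //; apply: mem_ideal_gen.
Qed.

(** [G] lifts generators of the coefficient ideals up to the stage [N] where they stabilize. A
    member of [I] is reduced by subtracting an element of [(G)] with the same leading coefficient,
    shifted by a power of ['X] when the degree exceeds [N]. *)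
Lemma hilbert_basis_ideal : fg_ideals R -> exists s, forall f, I f <-> seq_ideal s f.
Proof.
move=> fgR; have [N stabN] := coef_ideal_stable fgR.
have [G [GI Glift]] : exists G : seq {poly R}, (forall f, f \in G -> I f) /\
    forall m a, (m <= N)%N -> coef_ideal m a ->
      exists g, [/\ seq_ideal G g, (size g <= m.+1)%N & g`_m = a].
  elim: N {stabN} => [|N [G [GI Glift]]].
    have [G [GI Glift]] := coef_ideal_lift 0 fgR; exists G; split=> // m a.
    by rewrite leqn0 => /eqP->; apply: Glift.
  have [H [HI Hlift]] := coef_ideal_lift N.+1 fgR; exists (G ++ H); split.
    by move=> f; rewrite mem_cat => /orP[/GI|/HI].
  have sub (K K' : seq {poly R}) f : {subset K <= K'} -> seq_ideal K f -> seq_ideal K' f.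
    move=> sKK'; apply: ideal_gen_min; first exact: ideal_genP.
    by move=> z /sKK' zK'; apply: (mem_ideal_gen (G := fun x => x \in K')).
  move=> m a; rewrite leq_eqVlt => /predU1P[->|]; last rewrite ltnS => lemN.
    case/Hlift => g [Hg sg ga]; exists g; split=> //; apply: sub Hg => z.
    by rewrite mem_cat orbC => ->.
  case/(Glift _ _ lemN) => g [Gg sg ga]; exists g; split=> //; apply: sub Gg => z.
  by rewrite mem_cat => ->.
have idG : is_ideal (seq_ideal G) := ideal_genP _.
exists G => f; split; last exact: ideal_gen_min.
have [m] := ubnP (size f); elim: m f => // m IHm f; rewrite ltnS => sf If.
have [->|f0] := eqVneq f 0; first by case: idG.
have [[|j] sfE] : exists j, size f = j by exists (size f).
  by move/eqP: sfE; rewrite size_poly_eq0 (negPf f0).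
have Cf : coef_ideal j f`_j by exists f; rewrite sfE.
suff [g [Gg sg gj]] : exists g, [/\ seq_ideal G g, (size g <= j.+1)%N & g`_j = f`_j].
  have [_ GD _] := idG; rewrite -(subrK g f); apply: GD => //; apply: IHm.
    rewrite -sfE in sg; apply: leq_trans _ sf; rewrite sfE ltnS; apply/leq_sizeP => l.
    rewrite leq_eqVlt coefB => /predU1P[<-|ltjl]; first by rewrite gj subrr.
    by rewrite !nth_default ?subr0 ?sfE //; apply: leq_trans sg _; rewrite sfE.
  by apply: ideal_sub => //; apply: ideal_gen_min Gg.
have [lejN|ltNj] := leqP j N; first exact: Glift.
have [g [Gg sg gN]] := Glift N _ (leqnn _) (stabN _ _ Cf).
exists (g * 'X^(j - N)); split.
- exact: ideal_mulr.
- apply/leq_sizeP => l ltl; rewrite coefMXn; case: ltnP => // lel.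
  by apply: (leq_sizeP _ _ sg); lia.
- by rewrite coefMXn ltnNge leq_subr /= subKn // ltnW.
Qed.

End HilbertBasis.

Lemma fg_ideals_poly (R : comNzRingType) : fg_ideals R -> fg_ideals {poly R}.
Proof. by move=> fgR I idI; apply: hilbert_basis_ideal. Qed.

End Noetherian.

(** * Finitely generated algebras *)

Section Generated.

(** Generation of [Q] as an [R]-algebra, phrased as an induction principle so that a generator can
    be moved into the base ring as a polynomial variable. *)
Definition generated (R Q : comNzRingType) (phi : R -> Q) (s : seq Q) : Prop :=
  forall P : Q -> Prop, (forall r, P (phi r)) -> (forall x, x \in s -> P x) ->
    (forall x y, P x -> P y -> P (x + y)) -> (forall x y, P x -> P y -> P (x * y)) ->
    forall x, P x.

Variables (R Q : comNzRingType).
Implicit Types (phi : {rmorphism R -> Q}).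

Definition eval_morph phi (a : Q) : {rmorphism {poly R} -> Q} :=
  horner_morph (fun x => mulrC a (phi x)).

Lemma eval_morphE phi a p : eval_morph phi a p = (map_poly phi p).[a].
Proof. by []. Qed.

Lemma eval_morphC phi a c : eval_morph phi a c%:P = phi c.
Proof. exact: horner_morphC. Qed.

Lemma eval_morphX phi a : eval_morph phi a 'X = a.
Proof. exact: horner_morphX. Qed.

Lemma generated_cons phi a s : generated phi (a :: s) -> generated (eval_morph phi a) s.
Proof.
move=> gen P Pphi Ps; apply: gen => [r|x]; first by rewrite -(eval_morphC phi a).
by rewrite inE => /predU1P[->|/Ps//]; rewrite -(eval_morphX phi a).
Qed.

Lemma generated_nil phi : generated phi [::] -> forall q, exists x, phi x = q.
Proof.
apply=> // [r|_ _ [x <-] [y <-]|_ _ [x <-] [y <-]]; first by exists r.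
  by exists (x + y); rewrite rmorphD.
by exists (x * y); rewrite rmorphM.
Qed.

End Generated.

Lemma fg_ideals_generated (R Q : comNzRingType) (phi : {rmorphism R -> Q}) s :
  generated phi s -> fg_ideals R -> fg_ideals Q.
Proof.
elim: s R phi => [|a s IHs] R phi gen fgR.
  by apply: (fg_ideals_surj (f := phi)) fgR; apply: generated_nil.
exact: (IHs _ _ (generated_cons gen) (fg_ideals_poly fgR)).
Qed.

(** * Regular sequences and chains of primes *)

Section PrimeChains.
Variable R : comNzRingType.
Implicit Types (I M : R -> Prop) (P : {pred R}) (x y u : R) (s : seq R).

Lemma idealr_closed_ideal P : idealr_closed P -> is_ideal (fun x => x \in P).
Proof.
case=> P0 _ PD; split=> // [x y Px Py|a x Px]; first by rewrite -[x]mul1r PD.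
by rewrite -[a * x]addr0 PD.
Qed.

(** An ideal maximal among those containing [I] and disjoint from the multiplicative set [M] is
    prime. *)
Lemma prime_avoiding I M : is_ideal I -> M 1 ->
  (forall x y, M x -> M y -> M (x * y)) -> (forall x, I x -> ~ M x) ->
  exists P, [/\ prime_ideal P, forall x, I x -> x \in P & forall x, M x -> x \notin P].
Proof.
move=> idI M1 MM IM.
(* Zorn's lemma is applied to sets [A] whose union with [I] is the ideal in question, so that the
   empty chain too has an admissible union. *)
pose addI (A : R -> Prop) x := I x \/ A x.
have [|A [[idA dA] maxA]] := @classical_sets.Zorn_bigcup R
  (fun A => is_ideal (addI A) /\ forall x, addI A x -> ~ M x).
  move=> F FP totF; set U := classical_sets.bigcup _ _.
  have inU A x : F A -> A x -> U x by move=> FA Ax; exists A.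
  have memU x : addI U x -> I x \/ exists2 A, F A & A x.
    by case=> [|[A FA Ax]]; [left|right; exists A].
  split=> [|x /memU[|[A FA Ax]]]; last 2 first.
  - exact: IM.
  - by apply: (proj2 (FP A FA)); right.
  case: (idI) => I0 ID IMu; split; first by left.
    move=> x y /memU[Ix|[A FA Ax]] /memU[Iy|[B FB By]].
    - by left; apply: ID.
    - have [_ D _] := proj1 (FP B FB); case: (D x y); [by left|by right|by left|].
      by right; apply: inU FB _.
    - have [_ D _] := proj1 (FP A FA); case: (D x y); [by right|by left|by left|].
      by right; apply: inU FA _.
    - have [AB|BA] := totF A B FA FB.
        have [_ D _] := proj1 (FP B FB); case: (D x y); [by right; apply: AB|by right|by left|].
        by right; apply: inU FB _.
      have [_ D _] := proj1 (FP A FA); case: (D x y); [by right|by right; apply: BA|by left|].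
      by right; apply: inU FA _.
  move=> a x /memU[Ix|[A FA Ax]]; first by left; apply: IMu.
  have [_ _ Mu] := proj1 (FP A FA); case: (Mu a x); [by right|by left|].
  by right; apply: inU FA _.
have [A0 AD AM] := idA.
have meets u : ~ addI A u -> exists2 x, adjoin (addI A) u x & M x.
  move=> NAu; apply: boolp.contrapT => none.
  apply: (maxA (adjoin (addI A) u)).
    split=> [x Ax|sub]; first by apply: sub_adjoin; right.
    by apply: NAu; right; apply: sub; apply: mem_adjoin.
  have E x : addI (adjoin (addI A) u) x <-> adjoin (addI A) u x.
    by split=> [[Ix|//]|]; [apply: sub_adjoin; left|right].
  split; last by move=> x /E Bx Mx; apply: none; exists x.
  have [B0 BD BM] := adjoin_ideal u idA.
  split=> [|x y /E Bx /E By|a x /E Bx]; apply/E => //; [exact: BD|exact: BM].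
exists (fun x => boolp.asbool (addI A x)).
split=> [|x Ix|x Mx]; last 2 first.
- by apply/boolp.asboolP; left.
- by apply/negP => /boolp.asboolP/dA; apply.
split; first split.
- exact/boolp.asboolP.
- by apply/negP => /boolp.asboolP/dA; apply.
- move=> a x y /boolp.asboolP Ax /boolp.asboolP Ay; apply/boolp.asboolP.
  by apply: AD => //; apply: AM.
move=> u v /boolp.asboolP Auv; apply/orP.
case: (boolp.EM (addI A u)) => [Au|/meets[_ [a [r [Aa ->]]] Ma]].
  by left; apply/boolp.asboolP.
case: (boolp.EM (addI A v)) => [Av|/meets[_ [b [t [Ab ->]]] Mb]].
  by right; apply/boolp.asboolP.
(* If [u] and [v] are both outside, the product of the two elements of [M] lies in the ideal because
   [u * v] does, a contradiction. *)
case: (dA _ _ (MM _ _ Ma Mb)); rewrite mulrDl; apply: (AD); first exact: ideal_mulr.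
rewrite mulrDr; apply: (AD); first exact: (AM).
have -> : r * u * (t * v) = r * t * (u * v) by rewrite mulrACA.
exact: (AM).
Qed.

Lemma regular_prime_below s P i : regular_sequence s -> (i < size s)%N ->
  prime_ideal P -> (forall x, seq_ideal (take i.+1 s) x -> x \in P) ->
  exists Q : {pred R}, [/\ prime_ideal Q, forall x, seq_ideal (take i s) x -> x \in Q,
    {subset Q <= P} & s`_i \notin Q].
Proof.
move=> [reg _] lti [idP primeP] sP.
have [P0 P1 _] := idP; have [_ PD PM] := idealr_closed_ideal idP.
have idT : is_ideal (seq_ideal (take i s)) := ideal_genP _.
have regX u e : seq_ideal (take i s) (u * s`_i ^+ e) -> seq_ideal (take i s) u.
  elim: e => [|e IHe]; first by rewrite expr0 mulr1.
  by rewrite exprS mulrCA => /(reg i _ lti)/IHe.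
have sT x : seq_ideal (take i s) x -> x \in P.
  by move=> xT; apply: sP; rewrite (take_nth 0) // seq_ideal_rcons; apply: sub_adjoin.
have [] := @prime_avoiding (seq_ideal (take i s)) (fun x => exists u e, u \notin P /\ x = u * s`_i ^+ e).
- exact: idT.
- by exists 1, 0%N; rewrite mulr1.
- move=> _ _ [u [e [uP ->]]] [v [f [vP ->]]]; exists (u * v), (e + f)%N.
  split; last by rewrite exprD mulrACA.
  by apply/negP => /primeP; rewrite (negPf uP) (negPf vP).
- by move=> x xT [u [e [uP xE]]]; case/negP: uP; apply/sT/(regX _ e); rewrite -xE.
move=> Q [primeQ TQ QM]; exists Q; split=> //.
  move=> x xQ; apply: contraLR xQ => xP; apply: QM.
  by exists x, 0%N; rewrite mulr1.
by apply: QM; exists 1, 1%N; rewrite mul1r.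
Qed.

Lemma regular_sequence_chain s P : regular_sequence s -> prime_ideal P ->
  {subset s <= P} -> exists C, prime_chain_to P (size s) C.
Proof.
move=> regs primeP sP.
(* The chain is built downwards from [P], using the last element of [s] first; its lowest prime
   still contains the elements not yet used. *)
suff H : forall j, (j <= size s)%N -> exists C, prime_chain_to P j C /\
    forall x, seq_ideal (take (size s - j) s) x -> x \in C 0%N.
  by have [C [HC _]] := H _ (leqnn _); exists C.
elim=> [_|j IHj ltj].
  exists (fun _ => P); split; first by split.
  move=> x; apply: (ideal_gen_min (idealr_closed_ideal (proj1 primeP))) => z /mem_take.
  exact: sP.
have [C [[primeC ltC CP] sC]] := IHj (ltnW ltj).
have lti : (size s - j.+1 < size s)%N by lia.
have iE : (size s - j = (size s - j.+1).+1)%N by lia.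
rewrite iE in sC.
have [Q [primeQ sQ QC siQ]] := regular_prime_below regs lti (primeC 0%N isT) sC.
exists (fun i => if i is i'.+1 then C i' else Q); split=> //; split=> //.
  by case=> // i; rewrite ltnS => /primeC.
case=> [_|i]; last by rewrite ltnS => /ltC.
split=> // CQ; case/negP: siQ; apply: CQ; apply: sC.
by rewrite (take_nth 0) // seq_ideal_rcons; apply/mem_adjoin/ideal_genP.
Qed.

Lemma maximal_ideal_unit P u : maximal_ideal P -> u \notin P ->
  adjoin (fun x => x \in P) u 1.
Proof.
case=> idP maxP uP; have idPP := idealr_closed_ideal idP.
have [A0 AD AM] := adjoin_ideal u idPP.
apply: boolp.contrapT => N1; case/negP: uP.
apply: (maxP (fun x => boolp.asbool (adjoin (fun x => x \in P) u x))).
- split; first exact/boolp.asboolP.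
    by apply/negP => /boolp.asboolP.
  move=> c x y /boolp.asboolP Ax /boolp.asboolP Ay; apply/boolp.asboolP.
  by apply: AD => //; apply: AM.
- by move=> x xP; apply/boolp.asboolP/sub_adjoin.
- exact/boolp.asboolP/mem_adjoin.
Qed.

Lemma maximal_ideal_prime P : maximal_ideal P -> prime_ideal P.
Proof.
move=> maxP; have [idP _] := maxP; split=> // u v uvP.
have [_ PD PM] := idealr_closed_ideal idP.
apply/orP; have [uP|uP] := boolP (u \in P); [by left|right].
have [a [b [aP E]]] := maximal_ideal_unit maxP uP.
rewrite -[v]mul1r E mulrDl; apply: PD; first by rewrite mulrC; apply: PM.
by rewrite -mulrA; apply: PM.
Qed.

Lemma prime_idealXn P x e : prime_ideal P -> x ^+ e \in P -> x \in P.
Proof.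
case=> -[_ P1 _] primeP; elim: e => [|e IHe]; first by rewrite expr0 (negPf P1).
by rewrite exprS => /primeP/orP[].
Qed.

End PrimeChains.

(** * Zariski's lemma *)

Section AdjoinAlgebraic.
Variables (R : comNzRingType) (K : fieldType) (phi : {rmorphism R -> K}).
Variables (a : K) (c : R).
Local Notation psi := (eval_morph phi a).

(** Multiplying the relation of degree [e] for [a] by the power [e - 1] of its leading coefficient
    [b] gives a monic relation for [b * a]. The degree is taken after mapping by [phi], which may
    kill the top coefficients of [p]. *)
Lemma integral_lead_coef (p : {poly R}) : map_poly phi p != 0 -> psi p = 0 ->
  exists b, phi b != 0 /\ integralOver phi (phi b * a).
Proof.
set q := map_poly phi p => q0 qa0; pose e := (size q).-1; pose b := p`_e.
have e_gt0 : (0 < e)%N.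
  have : (1 < size q)%N by apply: (root_size_gt1 (a := a) q0); apply/rootP; rewrite -qa0.
  by rewrite /e; case: (size q) => [|[]].
have szq : size q = e.+1 by rewrite /e prednK // size_poly_gt0.
have phib : phi b = lead_coef q by rewrite lead_coefE -/e coef_map.
exists b; split; first by rewrite phib lead_coef_eq0.
exists ('X^e + \poly_(i < e) (p`_i * b ^+ (e.-1 - i))).
  by rewrite monicE lead_coefDl ?lead_coefXn // size_polyXn ltnS size_poly.
apply/rootP; rewrite rmorphD /= map_polyXn hornerD hornerXn.
rewrite (_ : map_poly phi _ = \poly_(i < e) phi (p`_i * b ^+ (e.-1 - i))); last first.
  by apply/polyP => i; rewrite coef_map !coef_poly; case: (i < e)%N; rewrite ?raddf0.
rewrite horner_poly; transitivity (phi b ^+ e.-1 * q.[a]); last first.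
  by rewrite (_ : q.[a] = 0) ?mulr0.
rewrite horner_coef szq big_ord_recr /= mulrDr addrC; congr (_ + _); last first.
  by rewrite exprMn mulrA (_ : q`_e = phi b) ?coef_map // -exprSr prednK.
rewrite mulr_sumr; apply: eq_bigr => i _.
rewrite /q coef_map /= rmorphM rmorphXn exprMn.
have -> : phi b ^+ e.-1 = phi b ^+ (e.-1 - i) * phi b ^+ i.
  by rewrite -exprD subnK // -ltnS prednK.
by rewrite [RHS]mulrACA (mulrC (phi p`_i)).
Qed.

Hypothesis int_ca : integralOver phi (phi c * a).

Lemma integral_clear (h : {poly R}) M : (size h <= M)%N ->
  integralOver phi (phi c ^+ M * psi h).
Proof.
move=> leM; have intX b j : integralOver phi b -> integralOver phi (b ^+ j).
  by move=> intb; elim: j => [|j IHj]; rewrite ?exprS; [exact: integral1|exact: integral_mul].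
rewrite eval_morphE (horner_coef_wide _ (leq_trans (size_poly _ _) leM)) mulr_sumr.
elim/big_ind: _ => [||i _]; [exact: integral0|exact: integral_add|].
rewrite coef_map (_ : _ * _ = phi (h`_i * c ^+ (M - i)) * (phi c * a) ^+ i).
  by apply: integral_mul; [exact: integral_id|exact: intX].
have -> : phi c ^+ M = phi c ^+ (M - i) * phi c ^+ i by rewrite -exprD subnK // ltnW.
by rewrite rmorphM rmorphXn exprMn [LHS]mulrACA (mulrC (phi h`_i)).
Qed.

(** For [M] bounding the sizes of the coefficients of the relation, c^M * u satisfies a monic
    relation whose coefficients are integral over [R] by [integral_clear]. *)
Lemma integral_over_adjoin u : integralOver psi u ->
  exists M, integralOver phi (phi c ^+ M * u).
Proof.
case=> p monp /rootP pu0; pose m := (size p).-1.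
have szp : size p = m.+1 by rewrite prednK // size_poly_gt0 monic_neq0.
pose M := (\max_(j < size p) size (p`_j)%R)%N; exists M.
pose r := \poly_(j < m.+1) (psi p`_j * phi c ^+ (M * (m - j))).
have rm : r`_m = 1.
  rewrite coef_poly ltnSn subnn muln0 expr0 mulr1.
  by move/monicP: monp; rewrite lead_coefE -/m => ->; rewrite rmorph1.
apply: (@integral_root_monic _ _ _ _ r).
- have szr : size r = m.+1.
    apply/eqP; rewrite eqn_leq size_poly /= ltnNge; apply/negP => /leq_sizeP/(_ m (leqnn _)).
    by rewrite rm => /eqP; rewrite oner_eq0.
  by rewrite monicE lead_coefE szr rm.
- apply/rootP; rewrite horner_poly; transitivity (phi c ^+ (M * m) * (map_poly psi p).[u]).
    rewrite (horner_coef_wide _ (size_poly _ _)) szp mulr_sumr; apply: eq_bigr => j _.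
    rewrite coef_poly ltn_ord exprMn.
    have -> : phi c ^+ (M * m) = phi c ^+ (M * (m - j)) * (phi c ^+ M) ^+ j.
      by rewrite -exprM -exprD -mulnDr subnK // -ltnS.
    by rewrite [RHS]mulrACA (mulrC (psi _)).
  by rewrite pu0 mulr0.
apply/integral_poly => j; rewrite coef_poly; case: ltnP => [|_]; last exact: integral0.
rewrite ltnS leq_eqVlt => /predU1P[->|ltjm].
  have := rm; rewrite coef_poly ltnSn => ->; exact: integral1.
have -> : (M * (m - j) = M * (m - j).-1 + M)%N by rewrite -mulnSr prednK ?subn_gt0.
rewrite exprD mulrCA -rmorphXn; apply: integral_mul; first exact: integral_id.
rewrite mulrC; apply: integral_clear.
have ltj : (j < size p)%N by rewrite szp ltnS ltnW.
exact: (leq_bigmax (Ordinal ltj)).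
Qed.

(* The multiple is the constant coefficient of an algebraic relation for psi h. *)
Lemma algebraic_multiple (h : {poly R}) : phi c != 0 -> psi h != 0 ->
  exists b (v : {poly R}), phi b != 0 /\ phi b = psi v * psi h.
Proof.
move=> c0 h0; pose t := (c ^+ size h)%:P * h.
have tE : psi t = phi c ^+ size h * psi h.
  by rewrite rmorphM /= eval_morphC rmorphXn.
have [p0 monp /rootP p0t] : integralOver phi (psi t).
  by rewrite tE; apply: integral_clear.
have mapp0 : map_poly phi p0 != 0 by apply/monic_neq0/monic_map.
(* As [psi t] is nonzero, factors ['X] can be stripped from the relation until its constant
   coefficient is nonzero under [phi]. *)
have [p [b [b0 pbt]]] : exists p b, phi b != 0 /\ (map_poly phi p).[psi t] * psi t + phi b = 0.
  elim/poly_ind: p0 mapp0 p0t {monp} => [|p b IHp]; first by rewrite rmorph0 eqxx.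
  rewrite rmorphD rmorphM /= map_polyX map_polyC /=.
  have [b0|b0] := eqVneq (phi b) 0.
    rewrite b0 addr0 hornerMX => pX0 /eqP; rewrite mulf_eq0 => /orP[/eqP pt|]; last first.
      by rewrite tE mulf_eq0 expf_eq0 (negPf c0) (negPf h0) andbF.
    by apply: IHp pt; apply: contraNneq pX0 => ->; rewrite mul0r.
  by rewrite hornerMXaddC => _ pt; exists p, b.
exists b, (- (p \Po t) * (c ^+ size h)%:P); split=> //.
have -> : phi b = - ((map_poly phi p).[psi t] * psi t).
  by apply/eqP; rewrite -addr_eq0 addrC pbt.
rewrite [in RHS]rmorphM [in RHS]rmorphN -[LHS]mulNr -[RHS]mulrA -rmorphM -/t; congr (- _ * _).
rewrite /comp_poly -horner_map -map_poly_comp; congr (_.[_]).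
by apply: eq_map_poly => r /=; rewrite eval_morphC.
Qed.

End AdjoinAlgebraic.

(** Stated over a ring so that the induction can move a generator [a] into the base. If [a] is
    algebraic over [R], the denominator [h] found over [R[X]] is traded for one in [R]; the
    transcendental case is contradictory. *)
Lemma zariski (R : comNzRingType) (K : fieldType) (phi : {rmorphism R -> K}) (s : seq K) :
  generated phi s ->
  exists r, phi r != 0 /\ forall x, exists N, integralOver phi (phi r ^+ N * x).
Proof.
elim: s R phi => [|a s IHs] R phi gen.
  exists 1; rewrite rmorph1 oner_eq0; split=> // x; exists 0%N.
  by have [y <-] := generated_nil gen x; rewrite expr0 mul1r; apply: integral_id.
have [h [h0 Hh]] := IHs _ _ (generated_cons gen); set psi := eval_morph phi a in h0 Hh.
case: (boolp.EM (exists2 p : {poly R}, psi p = 0 & map_poly phi p != 0)) => [[p pa p0]|tr].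
  have [c [c0 int_ca]] := integral_lead_coef p0 pa.
  have [b [v [b0 bE]]] := algebraic_multiple int_ca c0 h0.
  exists (b * c); split=> [|x]; first by rewrite rmorphM mulf_neq0.
  have [N intx] := Hh x.
  have {}intx : integralOver psi (phi b ^+ N * x).
    by rewrite bE exprMn -mulrA -rmorphXn; apply: integral_mul => //; apply: integral_id.
  have [M int_cx] := integral_over_adjoin int_ca intx; exists (N + M)%N.
  have -> : phi (b * c) ^+ (N + M) * x =
      phi (b ^+ M * c ^+ N) * (phi c ^+ M * (phi b ^+ N * x)).
    by rewrite !rmorphM !rmorphXn exprMn !exprD; ring.
  by apply: integral_mul => //; apply: integral_id.
(* [U] is coprime to [h] and not constant, so no power of [h] can clear the denominator of the
   inverse of [psi U]. *)
pose U := 1 + 'X * h; pose hb := map_poly phi h; pose Ub := 1 + 'X * hb.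
have mapU : map_poly phi U = Ub by rewrite rmorphD rmorph1 rmorphM /= map_polyX.
have psi0 p : psi p = 0 -> map_poly phi p = 0.
  by move=> pa; apply/eqP; apply: contra_notT tr => p0; exists p.
have hb0 : hb != 0.
  by apply: contraNneq h0 => hb0; rewrite /psi eval_morphE -/hb hb0 horner0.
have szU : size Ub = (size hb).+1.
  rewrite /Ub addrC mulrC size_polyDl size_mulX // size_polyC oner_eq0.
  by rewrite ltnS size_poly_gt0.
have U0 : psi U != 0.
  apply/eqP => /psi0; rewrite mapU => E; have := szU; rewrite E size_poly0 //.
have [N [p monp /rootP px]] := Hh (psi U)^-1; pose m := (size p).-1.
have szp : size p = m.+1 by rewrite prednK // size_poly_gt0 monic_neq0.
(* The monic relation for [psi h ^+ N / psi U], multiplied by the power [m] of [U]: every term but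
   the last is divisible by [U]. *)
pose E := \sum_(j < m.+1) p`_j * h ^+ (N * j) * U ^+ (m - j).
have /psi0 E0 : psi E = 0.
  transitivity (psi U ^+ m * (map_poly psi p).[psi h ^+ N * (psi U)^-1]); last by rewrite px mulr0.
  rewrite (horner_coef_wide _ (size_poly _ _)) szp mulr_sumr rmorph_sum; apply: eq_bigr => j _.
  rewrite coef_poly ltn_ord !rmorphM !rmorphXn exprMn exprVn -exprM.
  have -> : psi U ^+ (m - j) = psi U ^+ m * (psi U ^+ j)^-1.
    have lejm : (j <= m)%N by rewrite -ltnS.
    by rewrite -(mulfK (expf_neq0 j U0) (psi U ^+ (m - j))) -exprD subnK.
  by ring.
have UbE : Ub %| hb ^+ (N * m).
  have pm : p`_m = 1 by move/monicP: monp; rewrite lead_coefE.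
  move: E0; rewrite /E big_ord_recr /= subnn expr0 mulr1 pm mul1r rmorphD rmorphXn /= -/hb.
  move/eqP; rewrite addrC addr_eq0 => /eqP->; rewrite dvdpNr rmorph_sum /=.
  apply: (big_ind (fun z => Ub %| z)) => [|y z|j _]; [exact: dvdp0|exact: dvdp_add|].
  rewrite !rmorphM !rmorphXn /= mapU; apply: dvdp_mull.
  by rewrite -(prednK (_ : 0 < m - j)%N) ?subn_gt0 // exprS dvdp_mulr.
have copUb : coprimep Ub hb.
  apply/Bezout_coprimepP; exists (1, - 'X) => /=.
  by rewrite /Ub mul1r mulNr addrK eqpxx.
have /coprimepP/(_ Ub (dvdpp _) UbE) : coprimep Ub (hb ^+ (N * m)) by apply: coprimep_expr.
by rewrite -size_poly_eq1 szU eqSS size_poly_eq0 (negPf hb0).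
Qed.

Lemma algebraic_generated (k K : fieldType) (phi : {rmorphism k -> K}) (s : seq K) :
  generated phi s -> forall x, integralOver phi x.
Proof.
move=> gen x; have [r [r0 /(_ x)[N intx]]] := zariski gen.
rewrite -[x](mulKf (expf_neq0 N r0)) -rmorphXn -fmorphV.
by apply: integral_mul; [exact: integral_id|rewrite rmorphXn].
Qed.

(** * Bound on chains of primes *)

Section DimensionBound.
Variables (k : fieldType) (n : nat) (Q : comNzRingType).
Local Notation S := {mpoly k[n]}.
Variable pi : {rmorphism S -> Q}.
Implicit Types (P : {pred Q}) (I : finType) (f : S).

Definition independent_mod P I (e : I -> S) : Prop :=
  forall c : I -> k, pi (\sum_i c i *: e i) \in P -> forall i, c i = 0.

Definition mdeg_le f (b : nat) : Prop := forall m, m \in msupp f -> (mdeg m <= b)%N.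

Lemma mdeg_leM f g a b : mdeg_le f a -> mdeg_le g b -> mdeg_le (f * g) (a + b).
Proof.
move=> fa gb m /msuppM_le/allpairsP[[m1 m2]] /= [m1f m2g ->].
by rewrite mdegD leq_add ?fa ?gb.
Qed.

Lemma mdeg_le1 b : mdeg_le 1 b.
Proof. by move=> m; rewrite msupp1 inE => /eqP->; rewrite mdeg0. Qed.

Lemma mdeg_leX f b e : mdeg_le f b -> mdeg_le (f ^+ e) (e * b).
Proof.
move=> fb; elim: e => [|e IHe]; first by rewrite expr0; apply: mdeg_le1.
by rewrite exprS mulSn; apply: mdeg_leM.
Qed.

Lemma mdeg_le_trans f a b : (a <= b)%N -> mdeg_le f a -> mdeg_le f b.
Proof. by move=> leab fa m /fa lea; apply: leq_trans leab. Qed.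

(** Since [P] is prime and misses [x], the factor [x ^+ m] cancels; then [A m] is congruent modulo
    [P] to a multiple of [x], which is in [P']. *)
Lemma prime_lowest_term P P' x L (A : nat -> Q) m :
  prime_ideal P -> idealr_closed P' -> {subset P <= P'} -> x \in P' -> x \notin P ->
  (m < L)%N -> (forall j, (j < m)%N -> A j = 0) ->
  \sum_(j < L) A j * x ^+ j \in P -> A m \in P'.
Proof.
move=> primeP idP' PP' xP' xP ltmL A0 sumP; have [_ pP] := primeP.
pose Z := \sum_(j < L | (m < j)%N) A j * x ^+ (j - m.+1).
have sumE : \sum_(j < L) A j * x ^+ j = x ^+ m * (A m + x * Z).
  rewrite mulrDr mulrA -exprSr mulr_sumr (bigID (fun j : 'I_L => (m < j)%N)) /= addrC.
  congr (_ + _); last first.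
    apply: eq_bigr => j ltmj; rewrite mulrCA -exprD subnKC //.
  rewrite (bigD1 (Ordinal ltmL)) /= ?ltnn // big1 ?addr0 1?mulrC // => j.
  rewrite -leqNgt -val_eqE /= => /andP[lejm nejm].
  by rewrite A0 ?mul0r // ltn_neqAle nejm.
have : A m + x * Z \in P.
  by move: sumP; rewrite sumE => /pP/orP[/(prime_idealXn primeP)|//]; rewrite (negPf xP).
move/PP' => AZ; have idI := idealr_closed_ideal idP'.
rewrite -(addrK (x * Z) (A m)); apply: (ideal_sub idI) => //.
exact: (ideal_mulr (I := fun x => x \in P')).
Qed.

(** In a relation modulo [P], the lowest coefficient not yet known to vanish is a combination of the
    [e i] lying in [P'], so it vanishes by independence modulo [P']. *)
Lemma independent_step P P' (f : S) L I (e : I -> S) :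
  prime_ideal P -> idealr_closed P' -> {subset P <= P'} ->
  pi f \in P' -> pi f \notin P -> independent_mod P' e ->
  independent_mod P (fun ij : I * 'I_L => e ij.1 * f ^+ ij.2).
Proof.
move=> primeP idP' PP' fP' fP inde c sumP.
pose A j := if insub j is Some j' then pi (\sum_i c (i, j') *: e i) else 0.
have AE (j : 'I_L) : A j = pi (\sum_i c (i, j) *: e i) by rewrite /A valK.
have {}sumP : \sum_(j < L) A j * pi f ^+ j \in P.
  suff -> : \sum_(j < L) A j * pi f ^+ j = pi (\sum_i c i *: (e i.1 * f ^+ i.2)) by [].
  rewrite (eq_bigr (fun j : 'I_L => pi (\sum_i c (i, j) *: (e i * f ^+ j)))).
    rewrite -rmorph_sum exchange_big pair_bigA /=; congr (pi _).
    by apply: eq_bigr => -[i j] _.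
  move=> j _; rewrite AE -rmorphXn -rmorphM mulr_suml; congr (pi _).
  by apply: eq_bigr => i _; rewrite scalerAl.
suff H m : (m <= L)%N -> forall j : 'I_L, (j < m)%N -> forall i, c (i, j) = 0.
  by case=> i j; apply: (H L).
elim: m => // m IHm ltmL j; rewrite ltnS leq_eqVlt => /predU1P[jm|ltjm]; last first.
  exact: IHm (ltnW ltmL) _ ltjm.
apply: (inde (fun i => c (i, j))); rewrite -AE jm.
apply: (prime_lowest_term primeP idP' PP' fP' fP ltmL _ sumP) => l ltlm.
have ltlL := ltn_trans ltlm ltmL; have -> : l = Ordinal ltlL by [].
rewrite AE big1 ?rmorph0 // => i _.
by rewrite (IHm (ltnW ltmL)) ?scale0r.
Qed.

Hypothesis pi_surj : forall q, exists x, pi x = q.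

(** The family consists of the products of powers, with exponents below [L], of elements separating
    consecutive primes. The bound [b] on their degrees does not depend on [L]. *)
Lemma chain_independent P c C : prime_chain_to P c C -> exists b, forall L,
  exists I (e : I -> S), [/\ #|I| = (L ^ c)%N, independent_mod (C 0%N) e
    & forall i, mdeg_le (e i) (c * (L * b))].
Proof.
case=> primeC ltC _.
have /fin_all_exists[f fP] (i : 'I_c) : exists f, (pi f \in C i.+1) /\ (pi f \notin C i).
  have [_ nsub] := ltC i (ltn_ord i).
  apply: boolp.contrapT => none; apply: nsub => x xC; have [y yx] := pi_surj x.
  by apply: boolp.contrapT => /negP xN; apply: none; exists y; rewrite yx.
exists (\max_(i < c) msize (f i))%N => L; set b := (\max_(i < c) _)%N.
have fb i : mdeg_le (f i) b.
  move=> m /msize_mdeg_lt/ltnW/leq_trans; apply; exact: (leq_bigmax i).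
suff H j : (j <= c)%N -> exists I (e : I -> S), [/\ #|I| = (L ^ j)%N,
    independent_mod (C (c - j)%N) e & forall i, mdeg_le (e i) (j * (L * b))].
  by have := H c (leqnn _); rewrite subnn.
elim: j => [_|j IHj ltjc].
  exists unit, (fun _ => 1); split=> [||_]; first by rewrite card_unit.
    move=> a; rewrite subn0 (big_pred1 tt) => [aC [] |[]//].
    apply/eqP; apply: contraLR (leqnn c) => a0; have [[_ C1 _] _] := primeC c (leqnn c).
    case/negP: C1; have [_ _ CM] := idealr_closed_ideal (proj1 (primeC c (leqnn c))).
    have -> : 1 = pi ((a tt)^-1)%:MP * pi (a tt *: 1).
      by rewrite -rmorphM mul_mpolyC scalerA mulVf // scale1r rmorph1.
    exact: CM.
  exact: mdeg_le1.
have [I [e [cardI inde degI]]] := IHj (ltnW ltjc).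
have lti : (c - j.+1 < c)%N by lia.
have iE : (c - j = (c - j.+1).+1)%N by lia.
have [fC fC'] := fP (Ordinal lti); rewrite /= -iE in fC fC'.
exists (I * 'I_L)%type, (fun ij : I * 'I_L => e ij.1 * f (Ordinal lti) ^+ ij.2); split.
- by rewrite card_prod cardI card_ord expnSr.
- apply: independent_step fC fC' inde.
  + by apply: primeC; apply: leq_subr.
  + by case: (primeC (c - j)%N (leq_subr _ _)).
  + by have [sub _] := ltC _ lti; rewrite iE.
- move=> [i l] /=; rewrite mulSn addnC; apply: mdeg_leM; first exact: degI.
  apply: (@mdeg_le_trans _ (l * b)); last exact: mdeg_leX.
  by rewrite leq_mul2r ltnW ?orbT.
Qed.

(** Modulo [P] only monomials in the variables outside [P] survive, and at most [b.+1 ^ #|G|] of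
    these have degree at most [b]. A larger family has a combination with zero coefficient at all of
    them. *)
Lemma independent_card P I (e : I -> S) b : prime_ideal P ->
  independent_mod P e -> (forall i, mdeg_le (e i) b) ->
  (#|I| <= b.+1 ^ #|[set i | pi 'X_i \notin P]|)%N.
Proof.
move=> primeP inde dege; set G := [set i | _].
pose T := pffun_on (ord0 : 'I_b.+1) (mem G) predT : pred {ffun 'I_n -> 'I_b.+1}.
have -> : (b.+1 ^ #|G| = #|T|)%N by rewrite card_pffun_on card_ord.
rewrite leqNgt; apply/negP => ltTI.
pose A := \matrix_(i < #|I|, j < #|T|)
  (e (enum_val i))@_[multinom val (enum_val j l) | l < n] : 'M[k]_(#|I|, #|T|).
have : kermx A != 0.
  rewrite kermx_eq0 /row_free neq_ltn; apply/orP; left.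
  exact: leq_ltn_trans (rank_leq_col A) ltTI.
rewrite -nz_row_eq0; set c := nz_row _ => /eqP; case.
have cA : c *m A = 0 by apply/sub_kermxP/nz_row_sub.
pose p := \sum_i c 0 (enum_rank i) *: e i.
have pT m : (mdeg m <= b)%N -> (forall i, i \notin G -> m i = 0%N) -> p@_m = 0.
  move=> degm mG.
  have ltm i : (m i < b.+1)%N by rewrite ltnS (leq_trans _ degm) // mdegE (bigD1 i) //= leq_addr.
  pose a := [ffun i => Ordinal (ltm i)].
  have aT : a \in T.
    apply/pffun_onP; split=> [|x _ //].
    apply/supportP => i iG; apply/val_inj; rewrite ffunE /=; exact: mG.
  transitivity ((c *m A) 0 (enum_rank_in aT a)); last by rewrite cA mxE.
  rewrite mxE raddf_sum /= (reindex (@enum_val I predT)) /=; last first.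
    by apply: onW_bij; apply: enum_val_bij.
  apply: eq_bigr => i _; rewrite mxE mcoeffZ enum_valK enum_rankK_in //.
  by congr (_ * _@_ _); apply/mnmP => l; rewrite mnmE ffunE.
have piP : pi p \in P.
  have idI := idealr_closed_ideal (proj1 primeP); have [_ _ PM] := idI.
  rewrite [p]mpolyE rmorph_sum big_seq; apply: (@ideal_big _ (fun x => x \in P)) => // m mp.
  rewrite -mul_mpolyC rmorphM; apply: (PM).
  have /existsP[i /andP[iG mi]] : [exists i, (i \notin G) && (m i != 0%N)].
    apply: contraLR (mp) => /existsPn mG; rewrite mcoeff_msupp negbK; apply/eqP/pT.
      have : m \in msupp p by [].
      move/msupp_sum_le/flattenP => [s /mapP[i _ ->]] /msuppZ_le; exact: dege.
    by move=> i iG; have := mG i; rewrite iG negbK => /eqP.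
  rewrite -(submK (_ : U_(i) <= m)%MM) ?lep1mP // mpolyXD rmorphM; apply: PM.
  by move: iG; rewrite inE negbK.
by apply/rowP => j; rewrite mxE -(enum_valK j); apply: (inde (fun i => c 0 (enum_rank i))).
Qed.

Lemma chain_length_le (d : nat) P c C :
  (forall P', prime_ideal P' -> (#|[set i | pi 'X_i \notin P']| <= d)%N) ->
  prime_chain_to P c C -> (c <= d)%N.
Proof.
move=> dimP chainC; rewrite leqNgt; apply/negP => ltdc.
(* [L] exceeds [B ^ d], so [L ^ d.+1] exceeds [(B * L) ^ d], a bound on the available monomials. *)
have [b Hb] := chain_independent chainC; pose B := (c * b).+1; pose L := (B ^ d).+1.
have [I [e [cardI inde degI]]] := Hb L; have [primeC _ _] := chainC.
have := independent_card (primeC 0%N isT) inde degI; rewrite cardI => le1.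
have : (L ^ d.+1 <= (B * L) ^ d)%N.
  apply: leq_trans (leq_pexp2l _ ltdc) _ => //; apply: leq_trans le1 _.
  apply: leq_trans (leq_pexp2l _ (dimP _ (primeC 0%N isT))) _ => //.
  have leX x y l : (x <= y -> x ^ l <= y ^ l)%N by case: l => // l; rewrite leq_exp2r.
  by apply: leX; rewrite /B mulSn mulnCA (mulnC L) -[X in (X < _)%N]add0n ltn_add2r.
rewrite expnMn expnS leq_pmul2r ?expn_gt0 // leqNgt.
by rewrite ltnSn.
Qed.

End DimensionBound.

(** * Cohen-Macaulayness *)

Section Quotients.
Variable R : comNzRingType.

Lemma pi_ideal_quot_eq0 (J : idealr R) x :
  (\pi_({ideal_quot J})%qT x = 0) <-> x \in J.
Proof.
have := Quotient.idealrBE J x 0; rewrite subr0 => ->.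
by rewrite -(rmorph0 (\pi_({ideal_quot J})%qT)); split=> [->|/eqP].
Qed.

Lemma pi_ideal_quot_surj (J : idealr R) (y : {ideal_quot J}) :
  exists x, \pi_({ideal_quot J})%qT x = y.
Proof. by exists (repr y); rewrite reprK. Qed.

Lemma residue_field (P : {pred R}) : maximal_ideal P ->
  exists (K : fieldType) (rho : {rmorphism R -> K}),
    (forall y, exists x, rho x = y) /\ forall x, rho x = 0 <-> x \in P.
Proof.
move=> maxP; have [idP maxP'] := maxP.
pose J : idealr R := HB.pack (P : R -> bool) (isIdealr.Build R P idP).
have inv_ex (y : {ideal_quot J}) :
    exists z : {ideal_quot J}, (y != 0 -> z * y = 1) /\ (y = 0 -> z = 0).
  have [->|y0] := eqVneq y 0; first by exists 0.
  have [x xy] := pi_ideal_quot_surj y.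
  have xP : x \notin P.
    by apply: contra y0 => xP; apply/eqP; rewrite -xy; apply/pi_ideal_quot_eq0.
  have [a [b [aP E]]] := maximal_ideal_unit maxP xP.
  exists (\pi_({ideal_quot J})%qT b); split=> [_|y0']; last by rewrite y0' eqxx in y0.
  have /pi_ideal_quot_eq0 a0 : a \in J by [].
  have bxE : b * x = 1 - a by apply/eqP; rewrite eq_sym subr_eq addrC -E.
  by rewrite -xy -rmorphM bxE rmorphB /= a0 rmorph1 subr0.
have [inv invP] := boolp.choice inv_ex.
pose fieldB := GRing.ComNzRing_isField.Build {ideal_quot J}
  (fun y y0 => proj1 (invP y) y0) (proj2 (invP 0) erefl).
pose K : fieldType := HB.pack {ideal_quot J} fieldB.
exists K, (\pi_({ideal_quot J})%qT : {rmorphism R -> {ideal_quot J}}).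
by split=> [y|x]; [apply: pi_ideal_quot_surj|apply: pi_ideal_quot_eq0].
Qed.

End Quotients.

Lemma generated_mpoly (k : fieldType) n (Q : comNzRingType)
    (pi : {rmorphism {mpoly k[n]} -> Q}) : (forall q, exists x, pi x = q) ->
  generated (pi \o @mpolyC n k) [seq pi 'X_i | i <- enum 'I_n].
Proof.
move=> surj P PC PX PD PM q; have [x <-] := surj q.
elim/mpoly_alg_ind: x => [c|i|x y Px Py|x y Px Py].
- exact: PC.
- by apply: PX; apply: map_f; rewrite mem_enum.
- by rewrite rmorphD; apply: PD.
- by rewrite rmorphM; apply: PM.
Qed.

Lemma generated_comp (k : fieldType) (Q K : comNzRingType) (phi : {rmorphism k -> Q})
    (rho : {rmorphism Q -> K}) s : (forall y, exists x, rho x = y) ->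
  generated phi s -> generated (rho \o phi) (map rho s).
Proof.
move=> surj gen P Pphi Ps PD PM y; have [x <-] := surj y; move: x.
apply: gen => [r|x xs|x z|x z]; first exact: Pphi.
- by apply: Ps; apply: map_f.
- by rewrite rmorphD; apply: PD.
- by rewrite rmorphM; apply: PM.
Qed.

(** Height and depth of every maximal ideal are both [d]: the sequence of the [g c] at [theta c]
    bounds them from below, and the bound on chains of primes from above. *)
Theorem cohen_macaulay_criterion (k : fieldType) (n d : nat) (Q : comNzRingType)
    (pi : {rmorphism {mpoly k[n]} -> Q}) (theta : 'I_d -> Q) :
  (forall q, exists x, pi x = q) ->
  (forall P, prime_ideal P -> (#|[set i | pi 'X_i \notin P]| <= d)%N) ->
  (forall g : 'I_d -> {poly k}, (forall c, g c \is monic) ->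
     weakly_regular (fun x => x = 0)
       [seq poly_at (pi \o @mpolyC n k) (g c) (theta c) | c <- enum 'I_d]) ->
  cohen_macaulay_ring Q.
Proof.
move=> surj dimQ regQ; have gen := generated_mpoly surj.
split; first exact/fg_ideals_noetherian/(fg_ideals_generated gen)/fg_ideals_field.
move=> P maxP; have primeP := maximal_ideal_prime maxP.
have idP := idealr_closed_ideal (proj1 primeP).
have [K [rho [rho_surj rho0]]] := residue_field maxP.
have /fin_all_exists[g gP] (c : 'I_d) : exists g : {poly k},
    g \is monic /\ poly_at (pi \o @mpolyC n k) g (theta c) \in P.
  have [g mong /rootP g0] := algebraic_generated (generated_comp rho_surj gen) (rho (theta c)).
  by exists g; split=> //; apply/rho0; rewrite -horner_map -map_poly_comp.
set s := [seq poly_at (pi \o @mpolyC n k) (g c) (theta c) | c <- enum 'I_d].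
have sP : {subset s <= P} by move=> _ /mapP[c _ ->]; case: (gP c).
have size_s : size s = d by rewrite size_map size_enum_ord.
have reg_s : regular_sequence s.
  apply: regular_sequenceP; first by apply: regQ => c; case: (gP c).
  move=> s1; have [[_ P1 _] _] := primeP; case/negP: P1.
  exact: (ideal_gen_min idP sP).
exists d; split.
- by rewrite -size_s; apply: regular_sequence_chain.
- by move=> c C; apply: chain_length_le.
- by exists s.
- move=> t regt tP; have [C chainC] := regular_sequence_chain regt primeP tP.
  exact: chain_length_le chainC.
Qed.

(** * Primes over the clique tree ideal and Cohen-Macaulayness *)

Section CliqueTreeCM.
Variables (k : fieldType) (n d : nat) (D : {set {set 'I_n}}).
Variables (Ds : nat -> {set {set 'I_n}}) (Ts : nat -> rel {set 'I_n}).
Hypotheses (treeD : tree_complex D) (pureD : pure_of_size D d).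
Hypothesis itD : iterated_clique_tree D d Ds Ts.
Local Notation S := {mpoly k[n]}.
Local Notation M := (clique_tree_ideal k d Ds Ts).

Lemma clique_tree_ideal_ideal : is_ideal M.
Proof. by apply: ideal_sum_ideal => t; apply: ideal_genP. Qed.

Lemma clique_tree_ideal_proper : ~ M 1.
Proof.
move/(clique_tree_idealE pureD itD)/monomials_idealP => /(_ 0%MM).
rewrite msupp1 inE eqxx => /(_ isT)[_ [t [s [lttw sS ->]]]] /mnm_lepP le.
have [p [q [_ sE]]] := Sigma_pair pureD itD lttw sS; have := le p.
by rewrite mulmnE mnm_setE sE set21 mul1n mnm0E leqn0 subn_eq0 leqNgt lttw.
Qed.

(** The power [n - d] of the product of the variables in [G] is outside [P], hence outside [M]. Its
    level set at [r = 0] is [G], so [G] is a face of [D]. *)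
Lemma prime_over_clique_tree_ideal (P : S -> Prop) :
  (forall f, M f -> P f) -> ~ P 1 -> (forall f g, P (f * g) -> P f \/ P g) ->
  forall G : {set 'I_n}, (forall i, i \in G -> ~ P 'X_i) -> (#|G| <= d)%N.
Proof.
move=> MP P1 PM G NP; have [le_nd|lt_dn] := leqP n d.
  by apply: leq_trans (max_card _) _; rewrite card_ord.
have w_gt0 : (0 < n - d)%N by rewrite subn_gt0.
have NPe i e : i \in G -> ~ P ('X_i ^+ e).
  move=> iG; elim: e => [|e IHe]; first by rewrite expr0.
  by rewrite exprS => /PM[]; [apply: NP|].
have std : standard d Ds (mnm_set G *+ (n - d))%MM.
  apply: boolp.contrapT => /(clique_tree_gen_cover pureD itD) cov.
  have : P 'X_[mnm_set G *+ (n - d)].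
    by apply/MP/(clique_tree_idealE pureD itD)/monomials_idealX.
  rewrite -mpolyXn mpolyX_set -prodrXl.
  have : forall i, i \in enum G -> i \in G by move=> i; rewrite mem_enum.
  rewrite -big_enum /=; elim: (enum G) => [_|i s IHs sG]; first by rewrite big_nil.
  rewrite big_cons => /PM[]; first by apply: NPe; apply: sG; rewrite mem_head.
  by apply: IHs => j js; apply: sG; rewrite inE js orbT.
have := std 0%N w_gt0; have [-> _] := itD; rewrite subn0.
have -> : [set i | (n - d <= (mnm_set G *+ (n - d))%MM i)%N] = G.
  apply/setP => i; rewrite inE mulmnE mnm_setE.
  by case: (i \in G); rewrite ?mul1n ?leqnn // mul0n leqNgt w_gt0.
have [_ sz] := pureD; case/face_sub_facet => F FD /subset_leq_card.
by rewrite (sz F FD).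
Qed.

Lemma clique_tree_cohen_macaulay : cohen_macaulay_ideal M.
Proof.
have [M0 MD MM] := clique_tree_ideal_ideal.
have idJ : idealr_closed (fun f : S => boolp.asbool (M f)).
  split; first exact/boolp.asboolP.
    by apply/negP => /boolp.asboolP; apply: clique_tree_ideal_proper.
  move=> a f g /boolp.asboolP Mf /boolp.asboolP Mg; apply/boolp.asboolP.
  by apply: MD => //; apply: MM.
pose J : idealr S := HB.pack (fun f : S => boolp.asbool (M f)) (isIdealr.Build S _ idJ).
have JE f : f \in J <-> M f by split=> /boolp.asboolP.
exists J => //; pose pi : {rmorphism S -> {ideal_quot J}} := \pi_({ideal_quot J})%qT.
have pi0 f : pi f = 0 <-> M f by rewrite -JE; apply: pi_ideal_quot_eq0.
have [theta regM] := weakly_regular_clique_tree k pureD itD treeD.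
apply: (@cohen_macaulay_criterion k n d _ pi (fun c => pi (theta c))).
- exact: pi_ideal_quot_surj.
- move=> P [[P0 P1 _] primeP]; apply: (@prime_over_clique_tree_ideal (fun f => pi f \in P)).
  + by move=> f /pi0->.
  + by rewrite rmorph1; apply/negP.
  + by move=> f g; rewrite rmorphM => /primeP/orP.
  + by move=> i; rewrite inE => /negP.
move=> g mong; rewrite (eq_map (g := pi \o fun c => poly_at (@mpolyC n k) (g c) (theta c))).
  rewrite map_comp; apply: weakly_regular_morph; first exact: pi_ideal_quot_surj.
  by apply: weakly_regular_ext (regM g mong) => f; rewrite pi0.
by move=> c /=; rewrite /poly_at -horner_map -map_poly_comp.
Qed.

End CliqueTreeCM.

Theorem theorem4p14 (k : fieldType) (n d : nat) (Delta : {set {set 'I_n}})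
    (Ds : nat -> {set {set 'I_n}}) (Ts : nat -> rel {set 'I_n}) :
  tree_complex Delta ->
  cx_dim Delta = d%:Z - 1 ->
  iterated_clique_tree Delta d Ds Ts ->
  [/\ deformation (clique_tree_ideal k d Ds Ts) (stanley_reisner k Delta),
      generic_ideal (clique_tree_ideal k d Ds Ts)
    & cohen_macaulay_ideal (clique_tree_ideal k d Ds Ts)].
Proof.
move=> treeD dimD itD; have [cxD purD _] := treeD.
have pureD := pure_dim cxD purD dimD; split.
- exact: clique_tree_deformation pureD itD.
- exact: clique_tree_generic pureD itD.
- exact: clique_tree_cohen_macaulay treeD pureD itD.
Qed.
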